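(* Let $G=(V,E)$ be a connected graph which is either finite or infinite with bounded degrees, and consider the edge-averaging process $(f_t)_{t\ge0}$ on $G$. Suppose the initial opinions $\{f_0(v)\}_{v\in V}$ are i.i.d.\ and take values in $[-1,1]$, and let $\mu:=\mathbb{E}[f_0(v)]$. Fix $o\in V$. Then for every $t\ge 0$ and every $\varepsilon\in(0,1)$, $$\mathbb{P}\big(|f_t(o)-\mu|\ge\varepsilon\big)\le 3\exp\Big(-\frac{\varepsilon^2\sqrt{t_*}}{12}\Big),$$ where $t_*:=\min(t,|V|^2)$ (so $t_*=t$ if $V$ is infinite).
   Context: Edge-averaging process: each vertex $v\in V$ carries an opinion $f_t(v)\in\mathbb R$ at each time $t\ge 0$. Each edge carries an independent rate-one Poisson clock (clocks independent of the initial opinions). When the clock of edge $\{u,v\}$ rings at time $t$, both endpoints update to $f_t(u)=f_t(v)=\frac{f_{t-}(u)+f_{t-}(v)}{2}$, where $f_{t-}(u)=\lim_{s\uparrow t}f_s(u)$; other opinions are unchanged. *)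

(* Defs.v *)
From HB Require Import structures.
From mathcomp Require Import all_boot all_order all_algebra.
From mathcomp Require Import all_classical all_reals all_analysis.
Set Implicit Arguments. Unset Strict Implicit. Unset Printing Implicit Defensive.
Import Order.TTheory GRing.Theory Num.Theory.
Import numFieldNormedType.Exports.
Local Open Scope classical_set_scope.
Local Open Scope ring_scope.

Section Graph.
Variables (V E : Type) (ends : E -> V * V).

Definition incident (e : E) (v : V) : Prop := (ends e).1 = v \/ (ends e).2 = v.

Definition simple_graph : Prop :=
  (forall e, (ends e).1 <> (ends e).2) /\
  (forall e1 e2, ends e1 = ends e2 \/ ends e1 = ((ends e2).2, (ends e2).1) -> e1 = e2).

Definition adjacent (u v : V) : Prop :=
  exists e, ends e = (u, v) \/ ends e = (v, u).

Definition connected_graph : Prop :=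
  forall u v : V, exists (n : nat) (p : nat -> V),
    [/\ p 0%N = u, p n = v & forall i, (i < n)%N -> adjacent (p i) (p i.+1)].

Definition bounded_degree : Prop :=
  exists D : nat, forall (v : V) (n : nat) (g : 'I_n -> E),
    injective g -> (forall k, incident (g k) v) -> (n <= D)%N.
End Graph.

Definition has_card (V : Type) (n : nat) : Prop :=
  exists g : 'I_n -> V, bijective g.

Definition tstar {R : realType} (V : Type) (t : R) : R :=
  match pselect (exists n, has_card V n) with
  | left pf => Num.min t (((projT1 (cid pf))%:R) ^+ 2)
  | right _ => t
  end.

Section Prob.
Context {R : realType} {d : measure_display} {Omega : measurableType d}.
Variable P : probability Omega R.

Definition mutually_independent (I : Type) (X : I -> Omega -> R) : Prop :=
  forall (n : nat) (idx : 'I_n -> I) (B : 'I_n -> set R),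
    injective idx -> (forall k, measurable (B k)) ->
    P (\bigcap_(k in [set: 'I_n]) (X (idx k) @^-1` B k)) =
    (\prod_(k < n) P (X (idx k) @^-1` B k))%E.

Definition identically_distributed (X Y : Omega -> R) : Prop :=
  forall B : set R, measurable B -> P (X @^-1` B) = P (Y @^-1` B).

Definition exponential1 (X : Omega -> R) : Prop :=
  forall x : R, 0 <= x -> P [set w | x < X w] = (expR (- x))%:E.
End Prob.

Section Dynamics.
Context {R : realType} {Omega V E : Type} (ends : E -> V * V).
Variables (tau : E -> nat -> Omega -> R) (f : R -> V -> Omega -> R).

(* The Poisson clock of edge e (with interarrival times tau e k) rings at s *)
Definition rings (e : E) (w : Omega) (s : R) : Prop :=
  exists n : nat, s = \sum_(k < n.+1) tau e k w.

Definition edge_averaging_path (w : Omega) : Prop :=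
  (* opinions only change when an incident clock rings (right-continuous) *)
  (forall (v : V) (s s' : R), 0 <= s -> s < s' ->
     (forall e r, incident ends e v -> s < r <= s' -> ~ rings e w r) ->
     f s' v w = f s v w) /\
  (forall (e : E) (s : R), 0 < s -> rings e w s ->
     exists a b : R,
       [/\ (fun r => f r (ends e).1 w) @ s^'- --> a,
           (fun r => f r (ends e).2 w) @ s^'- --> b,
           f s (ends e).1 w = (a + b) / 2 &
           f s (ends e).2 w = (a + b) / 2]).
End Dynamics.

(* Main.v *)
(* Duality turns f_t(o) into an average of the initial opinions: running the
   clocks backwards from (o, t), a unit mass at o fragments (each ring averages
   the masses at the endpoints of the edge) into a mass m with total 1, and
   f_t(o) = sum_v m(v) f_0(v).  Given the clocks this is a sum of independent
   bounded variables, so Hoeffding's inequality gives 2 exp(-eps^2 / (2 Q)) with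
   Q = sum_v m(v)^2.  It remains to see that Q <= 6 / sqrt t_* up to probability
   exp(- sqrt t_* / 12).  A path from the maximum M of m to the nearest vertex of
   mass at most M / 2 has at most 2 / M edges, so by Cauchy-Schwarz the Dirichlet
   energy of m is at least M^3 / 8 >= Q^3 / 8; a ring lowers Q by half of the
   squared drop across its edge, hence exp(- Q^-2) decreases in mean at rate
   1 / 9 as long as Q > 6 / sqrt t_*.

   Everything is reduced to finite sums.  Interarrival times are cut into bins of
   length dl = t / M, so that by the product rule alone each clock becomes an exact
   Bernoulli sequence, and the initial opinions are cut into cells of length
   2 / L.  Rounding moves the k-th ring by at most k bins, so the true order of
   the rings can be read off the discretised one unless there are more than K
   rings, two of them within K bins of each other, or one after bin M.  Together
   with the event that the mass leaves a large ball, these exceptions have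
   probability tending to 0. *)
Require Import Defs.
From HB Require Import structures.
From mathcomp Require Import all_boot all_order all_algebra.
From mathcomp Require Import finmap ring lra.
From mathcomp Require Import all_classical all_reals all_analysis.
From mathcomp Require Import measurable_realfun.
Set Implicit Arguments. Unset Strict Implicit. Unset Printing Implicit Defensive.
Import Order.TTheory GRing.Theory Num.Theory.
Import numFieldNormedType.Exports.
Local Open Scope ring_scope.

(** * Hoeffding's lemma for a bounded variable *)

Lemma nondecreasing_from0 {R : realType} (f df : R -> R) (s : R) :
  (forall x : R, is_derive x (1 : R) f (df x)) -> (forall x, 0 <= x -> 0 <= df x) ->
  0 <= s -> f 0 <= f s.
Proof.
move=> fdf df0 s0.
have cf x : {for x, continuous f}.
  by apply/differentiable_continuous/derivable1_diffP; have [] := fdf x.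
have [c + E] := @MVT_segment R f df 0 s s0 (fun x _ => fdf x)
  (continuous_subspaceT cf).
rewrite in_itv /= => /andP[c0 _].
by rewrite -subr_ge0 E subr0 mulr_ge0// df0.
Qed.

(* With [C = al e^s + be e^-s], [al = (1+mu)/2] and [be = (1-mu)/2], the
   logarithmic derivative [u] of [C] satisfies [u' = 1 - u^2 <= 1] and
   [u 0 = mu]; hence [u <= mu + s], and [C exp (- (s mu + s^2/2))] decreases. *)
Lemma cosh_sinh_le_gauss_ge0 {R : realType} (mu s : R) :
  -1 <= mu <= 1 -> 0 <= s ->
  (1 - mu) / 2 * expR (- s) + (1 + mu) / 2 * expR s
    <= expR (s * mu + s ^+ 2 / 2).
Proof.
move=> /andP[mu1 mu2] s0.
set al := (1 + mu) / 2; set be := (1 - mu) / 2.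
have al0 : 0 <= al by rewrite /al; lra.
have be0 : 0 <= be by rewrite /be; lra.
pose C (x : R) := al * expR x + be * expR (- x).
pose D (x : R) := al * expR x - be * expR (- x).
have C_gt0 x : 0 < C x.
  have := expR_gt0 x; have := expR_gt0 (- x); rewrite /C /al /be.
  move: mu1; rewrite le_eqVlt => /orP[/eqP <-|mu1] *; last first.
    by apply: ltr_wpDr; [apply: mulr_ge0|apply: mulr_gt0]; lra.
  by rewrite (_ : (1 + -1)/2 = 0 :> R) ?mul0r ?add0r ?mulr_gt0; lra.
have dC x : is_derive x (1:R) C (D x).
  rewrite /C /D; apply: is_derive_eq.
  by rewrite /GRing.scale/=; ring.
have dD x : is_derive x (1:R) D (C x).
  rewrite /C /D; apply: is_derive_eq.
  by rewrite /GRing.scale/=; ring.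
have u_le (x : R) : 0 <= x -> D x / C x <= x + mu.
  move=> x0; pose H (y : R) := y + mu - D y * (C y)^-1.
  have dH y : is_derive y (1:R) H ((D y / C y) ^+ 2).
    have Cy := lt0r_neq0 (C_gt0 y).
    have dV := is_deriveV Cy (dC y).
    rewrite /H; apply: is_derive_eq.
    rewrite /GRing.scale/=; field; exact: Cy.
  have := @nondecreasing_from0 _ _ _ x dH (fun y _ => sqr_ge0 _) x0.
  rewrite /H /D /C !oppr0 !expR0 !mulr1 add0r.
  have -> : al - be = mu by rewrite /al /be; field.
  have -> : al + be = 1 by rewrite /al /be; field.
  by rewrite invr1 mulr1 subrr; lra.
pose Z (x : R) := - (C x * expR (- (x * mu + x ^+ 2 / 2))).
have dZ x : is_derive x (1:R) Z
   (((x + mu) * C x - D x) * expR (- (x * mu + x ^+ 2 / 2))).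
  rewrite /Z; apply: is_derive_eq.
  rewrite /GRing.scale/=; by field.
have Z0 : Z 0 = - 1.
  rewrite /Z /C mul0r expr0n mul0r addr0 !oppr0 !expR0 !mulr1.
  by rewrite /al /be; field.
have := @nondecreasing_from0 _ _ _ s dZ _ s0.
rewrite Z0 /Z lerN2 expRN.
have E0 := expR_gt0 (s * mu + s ^+ 2 / 2).
rewrite ler_pdivrMr // mul1r /C [leLHS]addrC; apply => y y0.
rewrite mulr_ge0 ?expR_ge0// subr_ge0.
by have := u_le y y0; rewrite ler_pdivrMr.
Qed.

(** Changing the signs of [mu] and [s] together swaps the two terms, so negative [s] reduces to
    positive [s]. *)
Lemma cosh_sinh_le_gauss {R : realType} (mu s : R) :
  -1 <= mu <= 1 ->
  (1 - mu) / 2 * expR (- s) + (1 + mu) / 2 * expR s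
    <= expR (s * mu + s ^+ 2 / 2).
Proof.
move=> mu1; have [s0|s0] := leP 0 s; first exact: cosh_sinh_le_gauss_ge0.
have mu1' : -1 <= - mu <= 1 by lra.
have s0' : 0 <= - s by lra.
have := cosh_sinh_le_gauss_ge0 mu1' s0'.
by rewrite !opprK mulrNN sqrrN addrC.
Qed.

(** * Fragmentation on a finite graph *)

Section Fragmentation.
Context {R : realType} {VT ET : finType} (en : ET -> VT * VT).
Implicit Types (m : VT -> R) (e : ET) (a s : seq (option ET)) (v x y : VT).

Definition avg (e : ET) (m : VT -> R) (v : VT) : R :=
  if (v == (en e).1) || (v == (en e).2)
  then (m (en e).1 + m (en e).2) / 2 else m v.

Definition step (i : option ET) (m : VT -> R) : VT -> R :=
  if i is Some e then avg e m else m.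

(** The word [a] lists the bins in order of time and [foldr] applies its last letter first, so the
    mass at [o] fragments backwards in time. *)
Definition frag (o : VT) (a : seq (option ET)) : VT -> R :=
  foldr step (fun v => (v == o)%:R) a.

Definition supp (m : VT -> R) : {set VT} := [set v | m v != 0].

Definition sqnorm (m : VT -> R) : R := \sum_v m v ^+ 2.

Definition drop_at (m : VT -> R) (e : ET) : R := m (en e).1 - m (en e).2.

Hypothesis loopless : forall e, (en e).1 != (en e).2.

Lemma sum_ends (F : VT -> R) e :
  \sum_v F v = F (en e).1 + F (en e).2
             + \sum_(v | (v != (en e).1) && (v != (en e).2)) F v.
Proof.
rewrite (bigD1 (en e).1) //= (bigD1 (en e).2) /= ?addrA//.
by rewrite eq_sym loopless.
Qed.

Lemma avg_1 e m : avg e m (en e).1 = (m (en e).1 + m (en e).2) / 2.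
Proof. by rewrite /avg eqxx. Qed.

Lemma avg_2 e m : avg e m (en e).2 = (m (en e).1 + m (en e).2) / 2.
Proof. by rewrite /avg eqxx orbT. Qed.

Lemma avg_out e m v : v != (en e).1 -> v != (en e).2 -> avg e m v = m v.
Proof. by rewrite /avg => /negPf -> /negPf ->. Qed.

(** One step of the duality: [g] and [g'] play the opinions just after and just before a ring at
    [e]. Off the edge only products with [m] are compared, because opinions outside the support are
    not controlled. *)
Lemma sum_avg_mul e m (g g' : VT -> R) :
  (forall v, v != (en e).1 -> v != (en e).2 -> m v * g v = m v * g' v) ->
  m (en e).1 * g (en e).1 + m (en e).2 * g (en e).2 =
    (m (en e).1 + m (en e).2) / 2 * (g' (en e).1 + g' (en e).2) ->
  \sum_v m v * g v = \sum_v avg e m v * g' v.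
Proof.
move=> Eout Ein; rewrite (sum_ends _ e) [RHS](sum_ends _ e) avg_1 avg_2 -mulrDr.
by rewrite Ein; congr (_ + _); apply: eq_bigr => v /andP[v1 v2];
  rewrite avg_out// Eout.
Qed.

Lemma sum_avg e m : \sum_v avg e m v = \sum_v m v.
Proof.
rewrite (sum_ends _ e) [RHS](sum_ends _ e) avg_1 avg_2 -splitr.
by congr (_ + _); apply: eq_bigr => v /andP[? ?]; rewrite avg_out.
Qed.

Lemma sqnorm_avg e m : sqnorm (avg e m) = sqnorm m - drop_at m e ^+ 2 / 2.
Proof.
rewrite /sqnorm (sum_ends _ e) [X in _ = X - _](sum_ends _ e) avg_1 avg_2.
rewrite (eq_bigr (fun v => m v ^+ 2)); first by rewrite /drop_at; field.
by move=> v /andP[? ?]; rewrite avg_out.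
Qed.

Lemma avg_ge0 e m : (forall v, 0 <= m v) -> forall v, 0 <= avg e m v.
Proof.
by move=> m0 v; rewrite /avg; case: ifP => // _; rewrite divr_ge0// addr_ge0.
Qed.

Lemma frag_ge0 o a v : 0 <= frag o a v.
Proof.
elim: a v => [|[e|] a IH] v //=.
exact: avg_ge0.
Qed.

Lemma frag_sum o a : \sum_v frag o a v = 1.
Proof.
elim: a => [|[e|] a IH] //=; last by rewrite sum_avg.
rewrite (bigD1 o)//= eqxx big1 ?addr0// => v /negPf ->.
by [].
Qed.

Lemma in_supp_avg e m : (forall v, 0 <= m v) -> forall v,
  (v \in supp (avg e m)) =
  if (v == (en e).1) || (v == (en e).2)
  then ((en e).1 \in supp m) || ((en e).2 \in supp m) else v \in supp m.
Proof.
move=> m0 v; rewrite !inE /avg; case: ifP => // _.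
by rewrite mulf_eq0 paddr_eq0// invr_eq0 pnatr_eq0 orbF negb_and.
Qed.

Lemma supp_avg_sub e m : (forall v, 0 <= m v) -> supp m \subset supp (avg e m).
Proof.
move=> m0; apply/fintype.subsetP => v vm; rewrite in_supp_avg//.
by case: ifP => // /orP[] /eqP <-; rewrite vm ?orbT.
Qed.

Definition touches e (S : {set VT}) : bool :=
  ((en e).1 \in S) || ((en e).2 \in S).

(** When [e] touches the support, only its other endpoint can be new. *)
Lemma card_supp_avg e m : (forall v, 0 <= m v) ->
  (#|supp (avg e m)| <= #|supp m| + touches e (supp m))%N.
Proof.
move=> m0; have [t|t] := boolP (touches e (supp m)); last first.
  rewrite addn0 subset_leq_card//; apply/fintype.subsetP => v.
  by rewrite in_supp_avg//; case: ifP => // _; move: t => /negPf; rewrite /touches => ->.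
wlog [y ysub] : / exists y, supp (avg e m) \subset y |: supp m.
  apply; case/orP: t => t.
    exists (en e).2; apply/fintype.subsetP => v; rewrite in_supp_avg// in_setU1.
    by case: ifP => [/orP[] /eqP ->|_ ->]; rewrite ?t ?eqxx ?orbT.
  exists (en e).1; apply/fintype.subsetP => v; rewrite in_supp_avg// in_setU1.
  by case: ifP => [/orP[] /eqP ->|_ ->]; rewrite ?t ?eqxx ?orbT.
apply: (leq_trans (subset_leq_card ysub)).
by rewrite cardsU1 addnC leq_add2l leq_b1.
Qed.

Lemma supp_step_sub i m : (forall v, 0 <= m v) -> supp m \subset supp (step i m).
Proof. by case: i => [e|] //=; exact: supp_avg_sub. Qed.

(* The support grows one neighbour at a time, so it stays within the ball
   whose radius is the number of vertices gained. *)
Lemma supp_frag_rank o (rk : VT -> nat) a :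
  rk o = 0%N ->
  (forall e, (rk (en e).1 <= (rk (en e).2).+1)%N) ->
  (forall e, (rk (en e).2 <= (rk (en e).1).+1)%N) ->
  forall v, v \in supp (frag o a) -> (rk v < #|supp (frag o a)|)%N.
Proof.
move=> rk0 rk12 rk21; elim: a => [|[e|] a IH] //= v.
  rewrite inE pnatr_eq0 eqb0 negbK => /eqP ->.
  by rewrite rk0 card_gt0; apply/set0Pn; exists o; rewrite inE eqxx oner_eq0.
have m0 := frag_ge0 o a; have := supp_avg_sub e m0; set S := supp _ => Ssub.
move=> vS'; have [vS|vS] := boolP (v \in S).
  exact: leq_trans (IH _ vS) (subset_leq_card Ssub).
have Slt : (#|S| < #|supp (avg e (frag o a))|)%N.
  apply: proper_card; apply/properP; split => //; exists v => //.
have: exists2 y, y \in S & (rk v <= (rk y).+1)%N.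
  move: vS'; rewrite in_supp_avg//; case: ifP => [|_]; last by rewrite (negPf vS).
  by case/orP => /eqP Ev /orP[] yS; move: vS; rewrite Ev ?yS// => _;
    [exists (en e).2|exists (en e).1].
by case=> y yS ry; apply: leq_trans Slt; rewrite ltnS (leq_trans ry)// IH.
Qed.

Lemma sqnorm_frag_gt0 o a : 0 < sqnorm (frag o a).
Proof.
rewrite lt0r; apply/andP; split; last by apply: sumr_ge0 => v _; exact: sqr_ge0.
apply/negP => /eqP /psumr_eq0P H; have := frag_sum o a.
rewrite big1 => [/eqP|v _]; first by rewrite eq_sym oner_eq0.
by apply/eqP; rewrite -sqrf_eq0 H// => i _; exact: sqr_ge0.
Qed.

Definition adj : rel VT :=
  [rel x y | [exists e, (en e == (x, y)) || (en e == (y, x))]].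

(* Cauchy-Schwarz along the path, in the form [2 a d - a^2 <= d^2]. *)
Lemma path_energy m (b : R) x (p : seq VT) :
  path adj x p -> uniq (x :: p) ->
  exists es : seq ET, [/\ uniq es,
    forall e, e \in es -> ((en e).1 \in x :: p) && ((en e).2 \in x :: p) &
    2 * b * (m x - m (last x p)) - (size p)%:R * b ^+ 2
      <= \sum_(e <- es) drop_at m e ^+ 2].
Proof.
elim: p x => [|y p IH] x.
  by move=> _ _; exists [::]; split => //=; rewrite subrr mulr0 mul0r subr0 big_nil.
move=> /= /andP[/existsP[e He] pyp] /andP[xNp Up].
have [es [Ues inc Ees]] := IH y pyp Up.
have eN : e \notin es.
  apply: contra xNp => /inc /andP[].
  by case/orP: He => /eqP -> /=.
exists (e :: es); split.
- by rewrite /= eN.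
- move=> e'; rewrite in_cons => /predU1P[->|/inc /andP[i1 i2]].
    by case/orP: He => /eqP -> /=; rewrite !inE !eqxx ?orbT.
  by rewrite !(in_cons x) i1 i2 !orbT.
rewrite big_cons; have dE : drop_at m e ^+ 2 = (m x - m y) ^+ 2.
  by case/orP: He => /eqP E; rewrite /drop_at E//= -sqrrN opprB.
rewrite dE -[(size (y :: p))%:R]natr1.
have := sqr_ge0 (m x - m y - b).
rewrite sqrrB; move: Ees; set l := last y p; set A := \sum_(_ <- _) _.
by lra.
Qed.
End Fragmentation.

(** * Energy decay *)

Section Energy.
Context {R : realType} {VT ET : finType} (en : ET -> VT * VT).
Implicit Types (m : VT -> R) (e : ET).
Hypothesis loopless : forall e, (en e).1 != (en e).2.

(* [q] stands for a lower bound on [sqnorm m <= max m], so that fewer than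
   [2 / q] vertices carry more than half of the maximal mass. *)
Definition small_sets_have_boundary (B : {set VT}) (q : R) : Prop :=
  forall H : {set VT}, H != finset.set0 -> H \subset B -> #|H|%:R < 2 / q ->
  exists e, ((en e).1 \in H) != ((en e).2 \in H).

(** Vertices of mass above [M / 2] number at most [2 / M], hence fewer than [2 / q], so by [cut] the
    component of the maximiser among them has an exit edge. A path through that exit drops by at
    least [M / 2] over few edges. *)
Lemma energy_ge (B : {set VT}) (q : R) m :
  small_sets_have_boundary B q ->
  (forall v, 0 <= m v) -> \sum_v m v = 1 -> supp m \subset B ->
  0 < q -> q < sqnorm m ->
  sqnorm m ^+ 3 / 8 <= \sum_e drop_at en m e ^+ 2.
Proof.
move=> cut m0 m1 mB q0 qm.
have [u0] : exists u : VT, true.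
  case: (pickP (@predT VT)) => [u _|VT0]; first by exists u.
  by move: m1; rewrite big_pred0// => /esym/eqP; rewrite oner_eq0.
move=> _; case: (@Order.TotalTheory.arg_maxP _ _ _ u0 predT m isT) => u _ umax.
have {}umax v : m v <= m u by exact: umax.
set M := m u in umax *.
have QM : sqnorm m <= M.
  rewrite -[leRHS]mulr1 -m1 mulr_sumr; apply: ler_sum => v _.
  by rewrite expr2 ler_wpM2r.
have M0 : 0 < M by lra.
pose H : {set VT} := [set v | M / 2 < m v].
have sumH (p : seq VT) : uniq p -> (forall v, v \in p -> v \in H) ->
    (size p)%:R * M <= 2.
  move=> Up pH; have : \sum_(v <- p) M / 2 <= \sum_v m v.
    rewrite big_uniq//= [leRHS](bigID (mem p))/=.
    rewrite -[leLHS]addr0 lerD ?sumr_ge0// ler_sum// => v /pH.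
    by rewrite inE => /ltW.
  by rewrite m1 big_const_seq count_predT iter_addr_0 -mulr_natl; lra.
have uH : u \in H by rewrite inE -/M; lra.
(* Each step only asks its target to lie in [H]; since [u] is in [H], the set [C] below is the
   component of [u] in [H]. *)
pose r := [rel x y | adj en x y && (y \in H)].
have rH p : path r u p -> {subset u :: p <= H}.
  elim/last_ind: p => [_ v|p x IH]; first by rewrite inE => /eqP ->.
  rewrite rcons_path => /andP[/IH pH /andP[_ xH]] v.
  by rewrite -rcons_cons mem_rcons in_cons => /predU1P[->//|/pH].
pose C : {set VT} := [set v | connect r u v].
have CH : C \subset H.
  apply/fintype.subsetP => v; rewrite inE => /connectP[p /rH pH ->].
  by apply: pH; exact: mem_last.
have HB : H \subset B.
  apply: fintype.subset_trans mB; apply/fintype.subsetP => v; rewrite !inE => Hv.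
  by rewrite gt_eqF//; apply: lt_trans Hv; rewrite divr_gt0.
have [|||e eC] := cut C.
- by apply/set0Pn; exists u; rewrite inE connect0.
- exact: fintype.subset_trans CH HB.
- have := sumH (enum C) (enum_uniq _); rewrite -cardE => sC.
  have {}sC : #|C|%:R * M <= 2.
    by apply: sC => v; rewrite mem_enum => /(fintype.subsetP CH).
  rewrite ltr_pdivlMr//; case: (posnP #|C|) => [->|C0]; first by rewrite mul0r.
  by apply: lt_le_trans sC; rewrite ltr_pM2l ?ltr0n//; lra.
have [x [y [xC yC xy]]] : exists x y, [/\ x \in C, y \notin C & adj en x y].
  have adj12 : adj en (en e).1 (en e).2.
    by apply/existsP; exists e; rewrite -surjective_pairing eqxx.
  have adj21 : adj en (en e).2 (en e).1.
    by apply/existsP; exists e; rewrite -surjective_pairing eqxx orbT.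
  case: (boolP ((en e).1 \in C)) eC => c1; case: (boolP ((en e).2 \in C)) => c2 // _.
    by exists (en e).1, (en e).2.
  by exists (en e).2, (en e).1.
have yH : y \notin H.
  apply: contra yC => yH; move: xC; rewrite !inE => xC.
  by apply: (connect_trans xC); apply: connect1; rewrite /= xy.
move: xC; rewrite inE => /connectP[p0 p0r].
(* Without repetitions the path visits at most [2 / M] vertices of [H]; their number [k] is also the
   number of edges once [y] is appended. *)
case/shortenP: p0r => p pr Up _ Ex.
have pH := rH _ pr.
have padj : path (adj en) u (rcons p y).
  rewrite rcons_path -Ex xy andbT; apply: sub_path pr => a b /=.
  by case/andP.
have Upy : uniq (u :: rcons p y).
  rewrite -rcons_cons rcons_uniq Up andbT.
  by apply: contra yH => /pH.
pose k : R := (size p).+1%:R.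
have k0 : 0 < k by rewrite /k ltr0n.
have kM : k * M <= 2 by apply: (sumH (u :: p)) => // v /pH.
(* The drop [M / 2] spread evenly over [k] edges: this [b] maximises [2 b (M / 2) - k b^2]. *)
have [es [Ues _]] := path_energy m (M / 2 / k) padj Upy.
rewrite last_rcons size_rcons -/k => Ees.
apply: (@le_trans _ _ (\sum_(e <- es) drop_at en m e ^+ 2)); last first.
  rewrite big_uniq//= [leRHS](bigID (mem es))/= lerDl sumr_ge0// => *.
  exact: sqr_ge0.
apply: le_trans Ees; rewrite -/M.
have my : m y <= M / 2 by move: yH; rewrite inE -leNgt.
have b0 : 0 <= M / 2 / k by rewrite !divr_ge0// ltW.
apply: (@le_trans _ _ (M ^+ 2 / 4 / k)).
  apply: (@le_trans _ _ (M ^+ 3 / 8)).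
    by rewrite ler_pM2r ?invr_gt0// lerXn2r ?nnegrE ?sumr_ge0// ?ltW// => *;
      exact: sqr_ge0.
  rewrite ler_pdivlMr//.
  have -> : M ^+ 3 / 8 * k = M ^+ 2 / 8 * (k * M) by ring.
  have -> : M ^+ 2 / 4 = M ^+ 2 / 8 * 2 by field.
  by rewrite ler_wpM2l// divr_ge0// sqr_ge0.
have -> : M ^+ 2 / 4 / k = 2 * (M / 2 / k) * (M / 2) - k * (M / 2 / k) ^+ 2.
  by field; rewrite gt_eqF.
rewrite lerD2r ler_wpM2l//; last lra.
by rewrite mulr_ge0.
Qed.

(** Induction from [(1 - e^-x) (1 - e^-y) >= 0] for [x, y >= 0]; nonnegativity of the partial sums
    is carried along for this. *)
Lemma sum_1mexpN_ge (I : finType) (x : I -> R) : (forall i, 0 <= x i) ->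
  1 - expR (- \sum_i x i) <= \sum_i (1 - expR (- x i)).
Proof.
move=> x0; suff [_] : 0 <= \sum_i x i /\
  1 - expR (- \sum_i x i) <= \sum_i (1 - expR (- x i)) by [].
elim/big_rec2: _ => [|i y1 y2 _ [y0 IH]]; first by rewrite oppr0 expR0 subrr.
split; first by rewrite addr_ge0.
have hx : expR (- x i) <= 1 by rewrite -expR0 ler_expR oppr_le0.
have hy : expR (- y2) <= 1 by rewrite -expR0 ler_expR oppr_le0.
have : 0 <= (1 - expR (- x i)) * (1 - expR (- y2)) by rewrite mulr_ge0 ?subr_ge0.
rewrite opprD expRD; lra.
Qed.

(* [Q^-2] is convex, and a ring at [e] lowers [Q] by half the squared drop. *)
Lemma inv_sqnorm_avg e m : 0 < sqnorm (avg en e m) ->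
  sqnorm m ^- 2 + drop_at en m e ^+ 2 / sqnorm m ^+ 3 <= sqnorm (avg en e m) ^- 2.
Proof.
rewrite sqnorm_avg//; set D := _ ^+ 2; set Q := sqnorm m => Q'.
have D0 : 0 <= D by exact: sqr_ge0.
have Q0 : 0 < Q by lra.
have -> : Q ^- 2 + D / Q ^+ 3 = (Q + D) / Q ^+ 3 by field; rewrite gt_eqF.
rewrite ler_pdivrMr ?exprn_gt0// -ler_pdivrMl; last by rewrite invr_gt0 exprn_gt0.
rewrite invrK !exprS expr0 !mulr1.
have : 0 <= D * D * (3 * (Q - D / 2) + D / 2).
  by rewrite mulr_ge0 ?(mulr_ge0 D0 D0)//; clear -D0 Q'; lra.
set X := Q * _ => H; rewrite -subr_ge0.
have -> : X - (Q - D / 2) * (Q - D / 2) * (Q + D) =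
  D * D * (3 * (Q - D / 2) + D / 2) / 4 + (X - Q * (Q * Q)) by field.
rewrite /X subrr addr0; lra.
Qed.

(** The exponents sum to at least [1 / 8] by the energy bound, and [e^(-1/8) <= 8 / 9] because
    [e^(1/8) >= 9 / 8]. *)
Lemma decay_rate (B : {set VT}) (q : R) m :
  small_sets_have_boundary B q ->
  (forall v, 0 <= m v) -> \sum_v m v = 1 -> supp m \subset B ->
  0 < q -> q < sqnorm m ->
  1 / 9 <= \sum_e (1 - expR (- (drop_at en m e ^+ 2 / sqnorm m ^+ 3))).
Proof.
move=> cut m0 m1 mB q0 qm.
have Q0 : 0 < sqnorm m by lra.
have E := energy_ge cut m0 m1 mB q0 qm.
have x0 e : 0 <= drop_at en m e ^+ 2 / sqnorm m ^+ 3.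
  by apply: divr_ge0; [exact: sqr_ge0|exact/exprn_ge0/ltW].
apply: le_trans (sum_1mexpN_ge x0); rewrite -mulr_suml.
have : 1 / 8 <= (\sum_e drop_at en m e ^+ 2) / sqnorm m ^+ 3.
  rewrite ler_pdivlMr ?exprn_gt0//.
  by rewrite mul1r mulrC.
move: (_ / sqnorm m ^+ 3) => x x8.
have ex : 9 / 8 <= expR x by apply: le_trans (expR_ge1Dx _); lra.
rewrite expRN lerBrDr -lerBrDl (_ : 1 - 1 / 9 = (9 / 8)^-1); last by field.
by rewrite lef_pV2 ?posrE ?expR_gt0 ?divr_gt0.
Qed.
End Energy.

(** * Weighted ring patterns *)

Section Patterns.
Context {R : realType} {ET : finType} (w0 w1 : R).
Implicit Types (s : seq (option ET)) (phi psi : seq (option ET) -> R).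

(** One letter per bin, [None] being silence. Bins in which two edges ring are not represented,
    which is why the total weight may fall short of 1. *)
Fixpoint patterns (n : nat) : seq (seq (option ET)) :=
  if n is n'.+1 then
    [seq x :: s | x <- None :: [seq Some e | e <- enum ET], s <- patterns n']
  else [:: [::]].

Definition weight (s : seq (option ET)) : R :=
  \prod_(x <- s) (if x is Some _ then w1 else w0).

Definition wsum (n : nat) (phi : seq (option ET) -> R) : R :=
  \sum_(s <- patterns n) weight s * phi s.

Definition rung (x : option ET) : bool := if x is Some _ then true else false.

Fixpoint close_pairs (K : nat) (s : seq (option ET)) : nat :=
  if s is x :: s' then
    ((if x is Some _ then count rung (take K s') else 0) + close_pairs K s')%N
  else 0%N.

Lemma size_patterns n s : s \in patterns n -> size s = n.
Proof.
elim: n s => [|n IH] s /=; first by rewrite inE => /eqP ->.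
rewrite mem_cat => /orP[/mapP[s' s'n ->]|/allpairsP[[x s'] /= [_ s'n ->]]] /=;
  by rewrite IH.
Qed.

Lemma uniq_patterns n : uniq (patterns n).
Proof.
elim: n => [|n IH] //.
rewrite [patterns _]/=.
apply: (@allpairs_uniq _ _ _ (fun x s => x :: s)
  (None :: [seq Some e | e <- enum ET])) => //.
  rewrite cons_uniq map_inj_uniq ?enum_uniq ?andbT; last by move=> ? ? [].
  by apply/mapP => -[].
by move=> [x s] [y t] _ _ /= [-> ->].
Qed.

Lemma wsum0 phi : wsum 0 phi = phi [::].
Proof. by rewrite /wsum /= big_seq1 /weight big_nil mul1r. Qed.

(** The head letter is summed inside, given the tail. As [frag] treats the head last, this is the
    conditional mean over one further backward step. *)
Lemma wsumS n phi :
  wsum n.+1 phi =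
  wsum n (fun s => w0 * phi (None :: s) + \sum_e w1 * phi (Some e :: s)).
Proof.
rewrite /wsum /= big_cat /= big_map big_allpairs_dep /= big_map big_enum /=.
rewrite exchange_big /= -big_split /=; apply: eq_bigr => s _.
rewrite mulrDr mulr_sumr /weight big_cons mulrCA -mulrA; congr (_ + _).
by apply: eq_bigr => e _; rewrite big_cons mulrCA -mulrA.
Qed.

Hypothesis w0_ge0 : 0 <= w0.
Hypothesis w1_ge0 : 0 <= w1.
Hypothesis w_le1 : w0 + #|ET|%:R * w1 <= 1.

Lemma weight_ge0 s : 0 <= weight s.
Proof. by apply: prodr_ge0 => -[]. Qed.

Lemma wsum_le n phi psi : (forall s, size s = n -> phi s <= psi s) ->
  wsum n phi <= wsum n psi.
Proof.
move=> le; rewrite /wsum big_seq [leRHS]big_seq; apply: ler_sum => s sn.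
by rewrite ler_wpM2l ?weight_ge0// le// (size_patterns sn).
Qed.

Lemma wsumD n phi psi : wsum n (fun s => phi s + psi s) = wsum n phi + wsum n psi.
Proof. by rewrite /wsum -big_split; apply: eq_bigr => s _; rewrite mulrDr. Qed.

Lemma wsumZ n c phi : wsum n (fun s => c * phi s) = c * wsum n phi.
Proof. by rewrite /wsum mulr_sumr; apply: eq_bigr => s _; rewrite mulrCA. Qed.

Lemma wsum_const n c : wsum n (fun=> c) = c * (w0 + #|ET|%:R * w1) ^+ n.
Proof.
elim: n => [|n IH]; first by rewrite wsum0 expr0 mulr1.
rewrite wsumS.
under [wsum _ _]eq_bigr do rewrite sumr_const -mulr_natl mulrA -mulrDl mulrCA.
by rewrite -mulr_sumr [X in _ * X]IH exprS mulrCA.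
Qed.

Lemma wsum_const_le n c : 0 <= c -> wsum n (fun=> c) <= c.
Proof.
move=> c0; rewrite wsum_const ler_piMr// exprn_ile1//.
by rewrite addr_ge0// mulr_ge0.
Qed.

Lemma wsum_supermart n (c : R) phi : 0 <= c ->
  (forall s, w0 * phi (None :: s) + \sum_e w1 * phi (Some e :: s) <= c * phi s) ->
  wsum n phi <= c ^+ n * phi [::].
Proof.
move=> c0 H; elim: n => [|n IH]; first by rewrite wsum0 expr0 mul1r.
rewrite wsumS exprS -mulrA; apply: le_trans (ler_wpM2l c0 IH).
by rewrite -wsumZ; apply: wsum_le => s _; exact: H.
Qed.

(** One-bin estimate behind the counting bounds: silence keeps the value below [b], a ring exceeds
    [b] by at most [g]. *)
Lemma step_le phi (b g : R) s : 0 <= b ->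
  phi (None :: s) <= b -> (forall e, phi (Some e :: s) <= g + b) ->
  w0 * phi (None :: s) + \sum_e w1 * phi (Some e :: s)
    <= b + #|ET|%:R * w1 * g.
Proof.
move=> b0 hN hS.
have h1 : w0 * phi (None :: s) <= w0 * b by exact: ler_wpM2l.
have h2 : \sum_e w1 * phi (Some e :: s) <= #|ET|%:R * w1 * (g + b).
  rewrite -mulrA mulr_natl -sumr_const; apply: ler_sum => e _.
  exact: ler_wpM2l.
have := ler_wpM2r b0 w_le1; rewrite mul1r; lra.
Qed.

Lemma wsum_take K n :
  wsum n (fun s => (count rung (take K s))%:R) <= K%:R * (#|ET|%:R * w1).
Proof.
elim: K n => [|K IH] n.
  rewrite mul0r; apply: le_trans (wsum_const_le n (lexx 0)).
  by apply: wsum_le => s _; rewrite take0.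
case: n => [|n].
  by rewrite wsum0 mulr_ge0// mulr_ge0.
rewrite wsumS; apply: le_trans
  (_ : wsum n (fun s => (count rung (take K s))%:R + #|ET|%:R * w1 * 1) <= _).
  apply: wsum_le => s _.
  apply: (step_le (phi := fun s => (count rung (take K.+1 s))%:R)) => //= e.
  by rewrite natrD.
rewrite wsumD -natr1 mulrDl lerD// mulr1 mul1r wsum_const_le// mulr_ge0//.
Qed.

Lemma wsum_count n :
  wsum n (fun s => (count rung s)%:R) <= n%:R * (#|ET|%:R * w1).
Proof.
apply: le_trans (wsum_take n n); apply: wsum_le => s sn.
by rewrite -sn take_size.
Qed.

Lemma wsum_drop M K :
  wsum (M + K) (fun s => (count rung (drop M s))%:R) <= K%:R * (#|ET|%:R * w1).
Proof.
elim: M => [|M IH].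
  by apply: le_trans (wsum_count K); apply: wsum_le => s _; rewrite drop0.
rewrite addSn wsumS; apply: le_trans IH; apply: wsum_le => s _.
have := @step_le (fun s => (count rung (drop M.+1 s))%:R)
  (count rung (drop M s))%:R 0 s.
by rewrite mulr0 addr0; apply => //= e; rewrite add0r.
Qed.

(** A ring at the head forms pairs with the rings of the next [K] bins, whose mean number is bounded
    by [wsum_take]; the product is quadratic in [w1]. *)
Lemma wsum_close_pairs K n :
  wsum n (fun s => (close_pairs K s)%:R)
    <= n%:R * (#|ET|%:R * w1 * (K%:R * (#|ET|%:R * w1))).
Proof.
have fw0 : 0 <= #|ET|%:R * w1 by rewrite mulr_ge0.
elim: n => [|n IH]; first by rewrite wsum0 mul0r.
rewrite wsumS; apply: le_trans (_ : wsum n (fun s => (close_pairs K s)%:R +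
    #|ET|%:R * w1 * (count rung (take K s))%:R) <= _).
  apply: wsum_le => s _.
  apply: (step_le (phi := fun s => (close_pairs K s)%:R)) => //= e.
  by rewrite natrD.
rewrite wsumD wsumZ -natr1 mulrDl mul1r lerD// ler_wpM2l//.
exact: wsum_take.
Qed.

End Patterns.

(** * Fragmentation driven by weighted patterns *)

Section FragmentationPatterns.
Context {R : realType} {VT ET : finType} (en : ET -> VT * VT) (w0 w1 : R) (o : VT).
Implicit Types (s : seq (option ET)).
Hypothesis loopless : forall e, (en e).1 != (en e).2.
Hypothesis w0_ge0 : 0 <= w0.
Hypothesis w1_ge0 : 0 <= w1.
Hypothesis w_le1 : w0 + #|ET|%:R * w1 <= 1.

(** At most [D #|S|] edges touch the support [S], each ringing with weight [w1], so the mean support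
    size grows by a factor of at most [1 + D w1] per bin. *)
Lemma wsum_card_supp (D n : nat) :
  (forall v, (#|[set e | ((en e).1 == v) || ((en e).2 == v)]| <= D)%N) ->
  wsum w0 w1 n (fun s => #|supp (frag en o s : VT -> R)|%:R)
    <= (1 + D%:R * w1) ^+ n.
Proof.
move=> degD; have D0 : 0 <= 1 + D%:R * w1 by rewrite addr_ge0// mulr_ge0.
apply: le_trans (@wsum_supermart _ _ w0 w1 w0_ge0 w1_ge0 n (1 + D%:R * w1) _ D0 _) _.
  move=> s /=; have m0 := @frag_ge0 R _ _ en o s.
  set m := frag en o s : VT -> R; set S := supp m.
  have : \sum_e #|supp (avg en e m)|%:R <=
      #|ET|%:R * #|S|%:R + D%:R * #|S|%:R :> R.
    apply: le_trans (_ : \sum_e (#|S|%:R + (touches en e S)%:R) <= _ :> R).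
      by apply: ler_sum => e _; rewrite -natrD ler_nat card_supp_avg.
    rewrite big_split /= sumr_const -[X in X + _ <= _]mulr_natl lerD2l.
    rewrite -natr_sum -natrM ler_nat.
    have tle e : (touches en e S <=
        \sum_(v in S) (((en e).1 == v) || ((en e).2 == v)))%N.
      case: (boolP (touches en e S)) => // /orP[] xS.
        by rewrite (bigD1 _ xS)/= eqxx.
      by rewrite (bigD1 _ xS)/= eqxx orbT.
    apply: (@leq_trans (\sum_e \sum_(v in S) (((en e).1 == v) || ((en e).2 == v))));
      first by apply: leq_sum => e _; exact: tle.
    rewrite exchange_big/= mulnC -sum_nat_const; apply: leq_sum => v _.
    apply: leq_trans (degD v); rewrite -sum1dep_card [leqRHS]big_mkcond/=.
    by apply: leq_sum => e _; case: ifP.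
  move=> /(ler_wpM2l w1_ge0); rewrite mulr_sumr => h.
  have := ler_wpM2r (ler0n R #|S|) w_le1.
  set A := \sum_(i | _) _ in h *; rewrite -/S; move: h; lra.
rewrite ger_pMr ?exprn_gt0 ?ltr_wpDr ?mulr_ge0//.
have -> : supp (frag en o [::] : VT -> R) = [set o].
  by apply/setP => v; rewrite !inE /= pnatr_eq0 eqb0 negbK.
by rewrite cards1.
Qed.

(** The function [e^(- Q^-2)], cut off to 0 outside the event, shrinks in mean by [1 - w1 / 9] per
    bin and starts below 1; on the event it exceeds [e^(- q^-2)], which gives the prefactor. *)
Lemma wsum_sqnorm_gt (B : {set VT}) (q : R) (n : nat) :
  small_sets_have_boundary en B q -> 0 < q -> w1 <= 1 ->
  wsum w0 w1 n (fun s =>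
      ((q < sqnorm (frag en o s)) && (supp (frag en o s : VT -> R) \subset B))%:R)
    <= expR (q ^- 2) * (1 - w1 / 9) ^+ n.
Proof.
move=> cut q0 w11.
pose ok s := (q < sqnorm (frag en o s)) && (supp (frag en o s : VT -> R) \subset B).
pose phi s : R := if ok s then expR (- sqnorm (frag en o s) ^- 2) else 0.
have c0 : 0 <= 1 - w1 / 9 by lra.
have phi0 s : 0 <= phi s by rewrite /phi; case: ifP.
apply: le_trans (_ : wsum w0 w1 n (fun s => expR (q ^- 2) * phi s) <= _).
  apply: wsum_le => // s _; rewrite -/(ok s) /phi; case: ifP => [/andP[Qq _]|_];
    last by rewrite mulr0.
  rewrite -expRD -expR0 ler_expR subr_ge0 lef_pV2 ?posrE ?exprn_gt0//.
    by rewrite lerXn2r ?nnegrE// ltW// (lt_trans q0).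
  exact: lt_trans Qq.
rewrite wsumZ ler_wpM2l ?expR_ge0//.
have hstep s : w0 * phi (None :: s) + \sum_e w1 * phi (Some e :: s)
    <= (1 - w1 / 9) * phi s.
  set m : VT -> R := frag en o s.
  have m0 : forall v, 0 <= m v := @frag_ge0 R _ _ en o s.
  (* A ring lowers [Q] and enlarges the support, so the event can only be lost and the cut-off never
     makes [phi] jump up. *)
  have okS e : ok (Some e :: s) -> ok s.
    rewrite /ok /= -/m => /andP[Qq sB]; apply/andP; split.
      apply: lt_le_trans Qq _; rewrite sqnorm_avg//.
      by rewrite gerBl divr_ge0// sqr_ge0.
    by apply: fintype.subset_trans sB; exact: supp_avg_sub.
  have phiN : phi (None :: s) = phi s by [].
  (* On the event this is the convexity bound [inv_sqnorm_avg] in exponential form. *)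
  have phiS e : phi (Some e :: s) <=
      phi s * expR (- (drop_at en m e ^+ 2 / sqnorm m ^+ 3)).
    rewrite {1}/phi; case: ifP => [okeS|_]; last by rewrite mulr_ge0.
    rewrite /phi (okS e okeS) -expRD ler_expR -opprD lerN2.
    by apply: inv_sqnorm_avg => //; exact: (@sqnorm_frag_gt0 R _ _ en loopless o (Some e :: s)).
  apply: le_trans (_ : w0 * phi s +
     \sum_e w1 * (phi s * expR (- (drop_at en m e ^+ 2 / sqnorm m ^+ 3))) <= _).
    by rewrite phiN lerD2l; apply: ler_sum => e _; rewrite ler_wpM2l.
  rewrite -!mulr_sumr; case: (boolP (ok s)) => oks; last first.
    by rewrite /phi (negPf oks) mul0r !mulr0 addr0.
  move: (oks) => /andP[Qq sB].
  have := decay_rate cut m0 (@frag_sum R _ _ en loopless o s) sB q0 Qq.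
  rewrite sumrB sumr_const -mulr_natl mulr1 -[#|_|]/#|ET|; set A := \sum_i _ => hA.
  rewrite mulrCA [w0 * _]mulrC -mulrDr [leRHS]mulrC ler_wpM2l//.
  by have := ler_wpM2l w1_ge0 hA; move: w_le1; lra.
apply: le_trans (wsum_supermart w0_ge0 w1_ge0 n c0 hstep) _.
rewrite ler_piMr ?exprn_ge0// /phi; case: ifP => // _.
by rewrite -expR0 ler_expR oppr_le0 invr_ge0 exprn_ge0// ltW// sqnorm_frag_gt0.
Qed.
End FragmentationPatterns.

(** * Hoeffding's inequality for finite product weights *)

Section Hoeffding.
Context {R : realType} {VT J : finType} (nu y : J -> R).
Hypothesis nu_ge0 : forall j, 0 <= nu j.
Hypothesis nu_sum1 : \sum_j nu j = 1.
Hypothesis y_bound : forall j, -1 <= y j <= 1.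

Let mean := \sum_j nu j * y j.

(** Convexity: the tangent at [s z] lies below the exponential at [- s] and at [s], and averaging
    the two inequalities with weights of barycentre [s z] cancels the slopes. *)
Lemma expR_le_chord (s z : R) : -1 <= z <= 1 ->
  expR (s * z) <= (1 - z) / 2 * expR (- s) + (1 + z) / 2 * expR s.
Proof.
move=> /andP[z1 z2].
have tangent (u : R) : expR (s * z) * (1 + (u - s * z)) <= expR u.
  rewrite -[in leRHS](subrK (s * z) u) [in leRHS]expRD [leRHS]mulrC.
  by rewrite ler_wpM2l ?expR_ge0// expR_ge1Dx.
have a0 : 0 <= (1 - z) / 2 by lra.
have b0 : 0 <= (1 + z) / 2 by lra.
have := ler_wpM2l a0 (tangent (- s)); have := ler_wpM2l b0 (tangent s).
set E := expR (s * z); lra.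
Qed.

(** The chord replaces the law by the two-point law on [-1] and [1] with the same mean, for which
    [cosh_sinh_le_gauss] applies. *)
Lemma hoeffding_mgf (s : R) :
  \sum_j nu j * expR (s * (y j - mean)) <= expR (s ^+ 2 / 2).
Proof.
have mean1 : -1 <= mean <= 1.
  rewrite -nu_sum1 -sumrN; apply/andP; split; apply: ler_sum => j _;
    have := nu_ge0 j; have /andP[y1 y2] := y_bound j => n0.
    by have := ler_wpM2l n0 y1; rewrite mulrN1.
  by have := ler_wpM2l n0 y2; rewrite mulr1.
have -> : s ^+ 2 / 2 = s * mean + s ^+ 2 / 2 - s * mean by ring.
rewrite expRD; apply: le_trans (ler_wpM2r (expR_ge0 _) (cosh_sinh_le_gauss s mean1)).
under eq_bigr do rewrite mulrBr expRD mulrA.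
rewrite -mulr_suml ler_wpM2r ?expR_ge0//.
apply: le_trans (_ : \sum_j nu j *
    ((1 - y j) / 2 * expR (- s) + (1 + y j) / 2 * expR s) <= _).
  by apply: ler_sum => j _; rewrite ler_wpM2l// expR_le_chord.
rewrite le_eqVlt; apply/orP; left; apply/eqP.
transitivity ((\sum_j nu j - \sum_j nu j * y j) / 2 * expR (- s) +
              (\sum_j nu j + \sum_j nu j * y j) / 2 * expR s); last by rewrite nu_sum1.
rewrite -sumrB -big_split/= !mulr_suml -big_split/=.
by apply: eq_bigr => j _; ring.
Qed.

Lemma hoeffding_upper (m : VT -> R) (r : R) : 0 < sqnorm m -> 0 < r ->
  \sum_(x : {ffun VT -> J}) (\prod_v nu (x v)) *
     (r <= \sum_v m v * (y (x v) - mean))%R%:R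
  <= expR (- (r ^+ 2 / (2 * sqnorm m))).
Proof.
set Q := sqnorm m => Q0 r0.
have nuP (x : {ffun VT -> J}) : 0 <= \prod_v nu (x v) by exact: prodr_ge0.
(* The Chernoff parameter minimising [- th r + th^2 Q / 2]. *)
pose th := r / Q; have th0 : 0 < th by rewrite divr_gt0.
apply: le_trans (_ : \sum_(x : {ffun VT -> J}) (\prod_v nu (x v)) *
   (expR (- (th * r)) * \prod_v expR ((th * m v) * (y (x v) - mean))) <= _).
  apply: ler_sum => x _; rewrite ler_wpM2l//.
  have -> : \prod_v expR ((th * m v) * (y (x v) - mean)) =
      expR (th * \sum_v m v * (y (x v) - mean)).
    by rewrite mulr_sumr expR_sum; apply: eq_bigr => v _; rewrite mulrA.
  rewrite -expRD -mulrN -mulrDr addrC; move: (\sum_v _) => z.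
  case: (boolP (r <= z)) => [h|_]; last exact: expR_ge0.
  by rewrite -expR0 ler_expR mulr_ge0 ?subr_ge0// ltW.
under eq_bigr do rewrite mulrCA -big_split/=.
rewrite -mulr_sumr.
rewrite -(bigA_distr_bigA (fun v j => nu j * expR (th * m v * (y j - mean)))).
apply: le_trans (_ : expR (- (th * r)) * \prod_v expR ((th * m v) ^+ 2 / 2) <= _).
  rewrite ler_wpM2l ?expR_ge0//; apply: ler_prod => v _.
  by rewrite hoeffding_mgf sumr_ge0// => j _; rewrite mulr_ge0// expR_ge0.
rewrite -expR_sum -expRD ler_expR -mulr_suml.
under eq_bigr do rewrite exprMn.
rewrite -mulr_sumr -/(sqnorm m) -/Q /th.
by rewrite le_eqVlt; apply/orP; left; apply/eqP; field; rewrite gt_eqF.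
Qed.

(** The one-sided bound is applied to [m] and to [- m]; the total mass 1 turns [mean] into a
    weighted sum of means. *)
Lemma hoeffding (m : VT -> R) (r : R) : 0 < sqnorm m -> 0 < r -> \sum_v m v = 1 ->
  \sum_(x : {ffun VT -> J}) (\prod_v nu (x v)) *
     (r <= `|\sum_v m v * y (x v) - mean|)%R%:R
  <= 2 * expR (- (r ^+ 2 / (2 * sqnorm m))).
Proof.
move=> Q0 r0 m1.
have Qopp : sqnorm (fun v => - m v) = sqnorm m.
  by apply: eq_bigr => v _; rewrite sqrrN.
have := hoeffding_upper Q0 r0.
have := @hoeffding_upper (fun v => - m v) r; rewrite Qopp => /(_ Q0 r0) h2 h1.
rewrite mulr_natl mulr2n; apply: le_trans (lerD h1 h2).
rewrite -big_split/=; apply: ler_sum => x _; rewrite -mulrDr ler_wpM2l//.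
  exact: prodr_ge0.
have -> : \sum_v m v * y (x v) - mean = \sum_v m v * (y (x v) - mean).
  under [RHS]eq_bigr do rewrite mulrBr.
  by rewrite sumrB -mulr_suml m1 mul1r.
under [X in _ + (_ <= X)%R%:R]eq_bigr do rewrite mulNr.
rewrite sumrN -natrD ler_nat ler_normr.
by case: (_ <= _); case: (_ <= _).
Qed.
End Hoeffding.

Local Open Scope classical_set_scope.
Local Open Scope ring_scope.

(** * Discretised clocks *)

Section Gaps.
Context {R : realType} (dl : R).
Hypothesis dl_ge0 : 0 <= dl.

(** Each interarrival time is rounded up on its own: a gap in [ring_gap c] counts as [c.+1] bins,
    one in [silent_gap c] outlasts [c] bins. By lack of memory the rounded exponential clock is
    exactly a Bernoulli sequence. *)
Definition ring_gap (c : nat) : set R := `](c%:R * dl), (c.+1%:R * dl)]%classic.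
Definition silent_gap (c : nat) : set R := `]c%:R * dl, +oo[%classic.

Lemma ring_gapE c x :
  ring_gap c x = (c%:R * dl < x <= c.+1%:R * dl) :> Prop.
Proof. by rewrite /ring_gap /= in_itv. Qed.

Lemma silent_gapE c x : silent_gap c x = (c%:R * dl < x) :> Prop.
Proof. by rewrite /silent_gap /= in_itv /= andbT. Qed.

(* [b] records, bin by bin, whether the discretised clock rings; [c] is the
   number of bins elapsed since its last ring. *)
Fixpoint gap_sets (c : nat) (b : seq bool) : seq (set R) :=
  match b with
  | [::] => [:: silent_gap c]
  | true :: b' => ring_gap c :: gap_sets 0 b'
  | false :: b' => gap_sets c.+1 b'
  end.

Definition in_gaps (tau : nat -> R) (gs : seq (set R)) : Prop :=
  forall k, (k < size gs)%N -> nth setT gs k (tau k).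

Lemma size_gap_sets c b : size (gap_sets c b) = (count id b).+1.
Proof. by elim: b c => [|[] b IH] c //=; rewrite IH. Qed.

Lemma measurable_gap_sets c b (k : nat) : measurable (nth setT (gap_sets c b) k).
Proof.
elim: b c k => [|[] b IH] c k /=; last exact: IH.
  by case: k => [|k] /=; [exact: measurable_itv|rewrite nth_nil; exact: measurableT].
by case: k => [|k] /=; [exact: measurable_itv|exact: IH].
Qed.

Lemma in_gaps_cons tau (A : set R) gs :
  in_gaps tau (A :: gs) <-> A (tau 0%N) /\ in_gaps (fun k => tau k.+1) gs.
Proof.
split=> [H|[H0 H] [|k] //=]; last exact: (H k).
by split; [exact: (H 0%N)|move=> k kgs; exact: (H k.+1)].
Qed.

Lemma in_gaps_head tau c b : in_gaps tau (gap_sets c b) -> c%:R * dl < tau 0%N.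
Proof.
elim: b c => [|[] b IH] c /=.
- by move=> /in_gaps_cons[]; rewrite silent_gapE.
- by move=> /in_gaps_cons[]; rewrite ring_gapE => /andP[].
- move=> /IH; apply: le_lt_trans; rewrite ler_wpM2r// ler_nat//.
Qed.

(** At the first bin where [b] and [b'] differ, the current gap would have both to end in that bin
    and to outlast it. *)
Lemma gap_sets_inj tau c b b' : size b = size b' ->
  in_gaps tau (gap_sets c b) -> in_gaps tau (gap_sets c b') -> b = b'.
Proof.
have ring_noring u d s s' : in_gaps u (gap_sets d (true :: s)) ->
    in_gaps u (gap_sets d (false :: s')) -> False.
  move=> /in_gaps_cons[]; rewrite ring_gapE => /andP[_ h] _ /(@in_gaps_head u d.+1 s').
  by rewrite ltNge h.
elim: b b' c tau => [|i b IH] [|i' b'] c tau //= [sb].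
case: i; case: i'.
- by move=> /in_gaps_cons[_ h] /in_gaps_cons[_ h']; rewrite (IH _ _ _ sb h h').
- by move=> h h'; case: (ring_noring tau c b b').
- by move=> h h'; case: (ring_noring tau c b' b).
- by move=> h h'; rewrite (IH _ _ _ sb h h').
Qed.

(** The rounded gaps add up to [(c + i.+1) dl], and each of the [j] gaps was rounded up by less than
    one bin. *)
Lemma ring_time_bounds tau c b (i : nat) : in_gaps tau (gap_sets c b) ->
  nth false b i ->
  let j := count id (take i.+1 b) in
  ((c + i.+1)%:R - j%:R) * dl < \sum_(k < j) tau k <= (c + i.+1)%:R * dl.
Proof.
elim: b c i tau => [|[] b IH] c i tau /=; first by rewrite nth_nil.
  move=> /in_gaps_cons[]; rewrite ring_gapE => /andP[h1 h2] h.
  case: i => [_|i bi].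
    by rewrite take0/= big_ord1/= addn1 -natr1 mulr1n addrK h1 natr1.
  have /= /andP[] := IH _ _ _ h bi.
  rewrite add0n => g1 g2; rewrite add1n big_ord_recl/=.
  rewrite addnS -addSn natrD -[(count _ _).+1%:R]natr1.
  move: h1 h2 g1 g2; rewrite -[c.+1%:R]natr1.
  set S := \sum_(_ < _) _; set C := (count _ _)%:R; move=> h1 h2 g1 g2; lra.
case: i => [//|i] h bi.
by have := IH _ _ _ h bi; rewrite /= add0n addSnnS.
Qed.

(** The gap in progress outlasts the recorded bins, so the first unrecorded ring comes at most [j]
    bins before their end. *)
Lemma next_ring_time tau c b : in_gaps tau (gap_sets c b) ->
  let j := count id b in
  ((c + size b)%:R - j%:R) * dl < \sum_(k < j.+1) tau k.
Proof.
elim: b c tau => [|[] b IH] c tau /=.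
- by move=> /(@in_gaps_head tau c [::]); rewrite big_ord1 addn0 subr0.
- move=> /in_gaps_cons[]; rewrite ring_gapE => /andP[h1 h2] /IH/=.
  rewrite add0n add1n [\sum_(_ < _.+2) _]big_ord_recl/= addnS.
  rewrite -[(c + size b).+1%:R]natr1 -[(count id b).+1%:R]natr1 natrD.
  set S := \sum_(_ < _) _; set C := (count _ _)%:R; move=> g; lra.
- by move=> /IH/=; rewrite add0n addSnnS.
Qed.

(** Each bin costs [e^-dl], and a ring replaces this by [1 - e^-dl = e^-dl (e^dl - 1)]. With [e^-dl]
    factored out of every bin, a ring costs a factor that does not depend on the other edges. *)
Lemma prod_gap_sets (mu : set R -> R) c b :
  (forall c : nat, mu (silent_gap c) = expR (- (c%:R * dl))) ->
  (forall c : nat, mu (ring_gap c) =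
     expR (- (c%:R * dl)) - expR (- (c.+1%:R * dl))) ->
  \prod_(A <- gap_sets c b) mu A =
  expR (- (c%:R * dl)) *
    \prod_(i <- b) (if i then expR dl - 1 else 1) * expR (- dl) ^+ size b.
Proof.
move=> muoo muoc.
have ES n : expR (- (n.+1%:R * dl)) = expR (- (n%:R * dl)) * expR (- dl).
  by rewrite -natr1 mulrDl mul1r opprD expRD.
elim: b c => [|[] b IH] c /=.
- by rewrite big_seq1 big_nil muoo !mulr1.
- rewrite !big_cons IH muoc ES mul0r oppr0 expR0 mul1r exprS.
  have -> : expR dl - 1 = (1 - expR (- dl)) * expR dl.
    by rewrite mulrBl mul1r [_ * expR dl]mulrC expRxMexpNx_1.
  have := expRxMexpNx_1 dl; set E := expR dl; set F := expR (- dl) => EF.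
  set X := \prod_(_ <- _) _; set Y := F ^+ _.
  transitivity (expR (- (c%:R * dl)) * (1 - F) * X * Y * 1); first by ring.
  by rewrite -EF; ring.
- rewrite IH ES big_cons exprS; ring.
Qed.
End Gaps.

(** * Opinions as averages of initial opinions *)

Section Representation.
Context {R : realType} {VT ET : finType} {V E : Type}
  (en : ET -> VT * VT) (ends : E -> V * V) (iV : VT -> V) (iE : ET -> E)
  (B : {set VT}) (rng : E -> R -> Prop) (h : R -> V -> R) (t : R) (o : VT).
Hypothesis loopless : forall e, (en e).1 != (en e).2.
Hypothesis iV_inj : injective iV.
Hypothesis endsE : forall e, ends (iE e) = (iV (en e).1, iV (en e).2).
Hypothesis B_interior : forall v, v \in B -> forall e, incident ends e (iV v) ->
  exists e', e = iE e'.
Hypothesis t_ge0 : 0 <= t.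
Hypothesis h_const : forall (v : V) (s s' : R), 0 <= s -> s < s' ->
  (forall e r, incident ends e v -> s < r <= s' -> ~ rng e r) -> h s' v = h s v.
Hypothesis h_ring : forall (e : E) (s : R), 0 < s -> rng e s ->
  exists a b : R, [/\ (fun r => h r (ends e).1) @ s^'- --> a,
    (fun r => h r (ends e).2) @ s^'- --> b,
    h s (ends e).1 = (a + b) / 2 & h s (ends e).2 = (a + b) / 2].

(** Induction over suffixes [s] of [a]: at a time [T] not before the rings of [pre] and before those
    of [s], the opinion at [(o, t)] is the [frag en o s] average of the opinions at [T]. All edges
    at a vertex of [B] belong to the finite graph, hence the condition on the support. *)
Lemma frag_representation (a : seq (option ET)) (rt : nat -> R) :
  (forall i e, nth None a i = Some e -> rng (iE e) (rt i) /\ 0 < rt i <= t) ->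
  (forall i j e e', (i < j)%N -> nth None a i = Some e ->
     nth None a j = Some e' -> rt i < rt j) ->
  (forall e r, rng (iE e) r -> 0 < r <= t ->
     exists2 i, nth None a i = Some e & r = rt i) ->
  supp (frag en o a : VT -> R) \subset B ->
  h t (iV o) = \sum_v frag en o a v * h 0 (iV v).
Proof.
move=> ring_at ring_lt ring_ex suppB.
suff: forall s pre T, a = pre ++ s -> supp (frag en o s : VT -> R) \subset B ->
    0 <= T <= t ->
    (forall j e, (size pre <= j)%N -> nth None a j = Some e -> T < rt j) ->
    (forall j e, (j < size pre)%N -> nth None a j = Some e -> rt j <= T) ->
    h t (iV o) = \sum_v frag en o s v * h T (iV v).
  move=> /(_ a [::] 0); apply => //; first by rewrite lexx.
  by move=> j e _ /ring_at[_ /andP[]].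
elim=> [|i s IH] pre T aE sB /andP[T0 Tt] rt_gt rt_le.
  have oB : o \in B by apply: (fintype.subsetP sB); rewrite inE /= eqxx oner_eq0.
  rewrite (bigD1 o)//= eqxx mul1r big1 ?addr0; last first.
    by move=> v /negPf -> /=; rewrite mul0r.
  have [->//|Tt'] := eqVneq t T.
  have {}Tt' : T < t by rewrite lt_neqAle eq_sym Tt'.
  apply: h_const => // e r /(B_interior oB)[e' ->] /andP[Tr rt_] /ring_ex[].
    by rewrite (le_lt_trans T0 Tr).
  move=> j je rE.
  suff jp : (j < size pre)%N by have := rt_le _ _ jp je; rewrite -rE leNgt Tr.
  rewrite -[pre]cats0 -aE; case: (ltnP j (size a)) => // sj.
  by move: je; rewrite nth_default.
have aE' : a = rcons pre i ++ s by rewrite cat_rcons.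
have sB' : supp (frag en o s : VT -> R) \subset B.
  apply: fintype.subset_trans sB; apply: supp_step_sub => //.
  exact: frag_ge0.
have ai : nth None a (size pre) = i by rewrite aE nth_cat ltnn subnn.
case: i => [e|] in ai aE aE' sB *; last first.
  apply: (IH (rcons pre None)) => //; first by rewrite T0.
    by move=> j e; rewrite size_rcons => /ltnW; exact: rt_gt.
  move=> j e; rewrite size_rcons ltnS leq_eqVlt => /predU1P[->|]; last exact: rt_le.
  by rewrite ai.
have [rngT1 /andP[T1_gt0 T1_le]] := ring_at _ _ ai.
have TT1 := rt_gt _ _ (leqnn _) ai.
set T1 := rt _ in rngT1 T1_gt0 T1_le TT1.
rewrite (IH (rcons pre (Some e)) T1) //; first last.
- move=> j e'; rewrite size_rcons ltnS leq_eqVlt => /predU1P[->|jp je]; first by [].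
  exact/ltW/(ring_lt _ _ _ _ jp je ai).
- by move=> j e'; rewrite size_rcons => jp je; exact: (ring_lt _ _ _ _ jp ai je).
- by rewrite T1_le (ltW T1_gt0).
(* Opinions in [B] do not move between [T] and the next ring time [T1], and away from the ringing
   edge not at [T1] either. *)
have noring v r : v \in B -> T < r -> r <= T1 ->
    (r = T1 -> ~~ ((v == (en e).1) || (v == (en e).2))) -> h r (iV v) = h T (iV v).
  move=> vB Tr rT1 vN; apply: h_const => // e' r' inc /andP[Tr' r'r].
  have [e'' E'] := B_interior vB inc; subst e'.
  move=> /ring_ex[|j je r'E].
    by rewrite (le_lt_trans T0 Tr') (le_trans r'r)// (le_trans rT1).
  have jp : j = size pre.
    apply/eqP; rewrite eqn_leq; apply/andP; split; rewrite leqNgt; apply/negP => jp.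
      have := ring_lt _ _ _ _ jp ai je.
      by rewrite -r'E -/T1 ltNge (le_trans r'r rT1).
    by have := rt_le _ _ jp je; rewrite -r'E leNgt Tr'.
  move: je; rewrite jp ai => -[ee]; subst e''.
  have : ~~ ((v == (en e).1) || (v == (en e).2)).
    by apply: vN; apply: le_anti; rewrite rT1 -(_ : r' = T1)// r'E jp.
  by case: inc; rewrite endsE/= => /iV_inj ->; rewrite eqxx ?orbT.
have leftlim v (c : R) : v \in B -> (fun r => h r (iV v)) @ T1^'- --> c ->
    c = h T (iV v).
  move=> vB hc; apply: cvg_unique hc _; first exact: norm_hausdorff.
  apply: cvg_near_cst; near=> r; apply: (noring v r vB).
  - by near: r; exact: nbhs_left_gt.
  - by apply/ltW; near: r; exact: nbhs_left_lt.
  - move=> rT1; have : r < T1 by near: r; exact: nbhs_left_lt.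
    by rewrite rT1 ltxx.
have m0 := @frag_ge0 R _ _ en o s.
apply: (sum_avg_mul loopless) => [v v1 v2|].
  have [->|vm] := eqVneq (frag en o s v : R) 0; first by rewrite !mul0r.
  congr (_ * _); apply: noring => //; last by rewrite negb_or v1 v2.
  by apply: (fintype.subsetP sB'); rewrite inE.
(* If the edge misses the support both masses vanish. Otherwise both endpoints enter the new support
   and so lie in [B]. *)
have [tch|] := boolP (touches en e (supp (frag en o s : VT -> R))); last first.
  rewrite negb_or !inE !negbK => /andP[/eqP -> /eqP ->].
  by rewrite addr0 !mul0r addr0.
have xB : (en e).1 \in B.
  by apply: (fintype.subsetP sB); rewrite in_supp_avg// eqxx.
have yB : (en e).2 \in B.
  by apply: (fintype.subsetP sB); rewrite in_supp_avg// eqxx orbT.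
have [a1 [b1 []]] := h_ring T1_gt0 rngT1; rewrite endsE/=.
by move=> /(leftlim _ _ xB) -> /(leftlim _ _ yB) -> -> ->; field.
Unshelve. all: by end_near.
Qed.
End Representation.

Lemma exists_nth_count (b : seq bool) (n : nat) : (n < count id b)%N ->
  exists2 i, nth false b i & count id (take i.+1 b) = n.+1.
Proof.
elim: b n => [|[] b IH] n //=.
  case: n => [_|n]; first by exists 0%N; rewrite ?take0.
  by rewrite add1n ltnS => /IH[i bi ci]; exists i.+1 => //=; rewrite ci.
by rewrite add0n => /IH[i bi ci]; exists i.+1.
Qed.

Lemma sum_pos_increasing {R : realType} (tau : nat -> R) (m n : nat) :
  (forall k, 0 < tau k) -> (m <= n)%N -> \sum_(k < m) tau k <= \sum_(k < n) tau k.
Proof.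
move=> tau0 /subnK <-; elim: (n - m)%N => [|k IH]; first by rewrite add0n.
by rewrite addSn big_ord_recr/=; have := tau0 (k + m)%N; lra.
Qed.

(** * Recovering the true order of the rings *)

Section RingTimes.
Context {R : realType} {ET : finType}.
Implicit Types (a : seq (option ET)) (e : ET).

Definition ringing e a : seq bool := [seq x == Some e | x <- a].

(** The true time of the ring recorded in bin [i]; the value 0 at silent bins is a dummy. *)
Definition ring_time (tau : ET -> nat -> R) a (i : nat) : R :=
  if nth None a i is Some e
  then \sum_(k < count id (take i.+1 (ringing e a))) tau e k else 0.

Lemma nth_count_rung a i e : nth None a i = Some e -> (0 < count (@rung ET) a)%N.
Proof.
move=> ai; rewrite -has_count; apply/(has_nthP None); exists i; rewrite ?ai//.
by case: (ltnP i (size a)) => // /(nth_default None); rewrite ai.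
Qed.

Lemma count_ringing e a : (count id (ringing e a) <= count (@rung ET) a)%N.
Proof. by rewrite count_map; apply: sub_count => x /= /eqP ->. Qed.

Lemma count_take_ringing e a i :
  (count id (take i (ringing e a)) <= count (@rung ET) a)%N.
Proof.
apply: leq_trans (count_ringing e a).
by rewrite -[X in (_ <= count _ X)%N](cat_take_drop i) count_cat leq_addr.
Qed.

Lemma nth_ringing e a i : nth false (ringing e a) i = (nth None a i == Some e).
Proof.
case: (ltnP i (size a)) => ia; first by rewrite (nth_map None).
by rewrite !nth_default// size_map.
Qed.

Lemma close_pairs_lt K a i j e e' : close_pairs K a = 0%N -> (i < j)%N ->
  nth None a i = Some e -> nth None a j = Some e' -> (i + K < j)%N.
Proof.
elim: a i j => [|x a IH] i [|j] //=.
move=> /eqP; rewrite addn_eq0 => /andP[/eqP cx /eqP cp].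
case: i => [_|i] /=; last by rewrite ltnS addSn => ij ai aj; exact: (IH i j).
move=> xe aj; rewrite add0n ltnS leqNgt; apply/negP => jK; move: cx; rewrite xe.
have : nth None (take K a) j = Some e' by rewrite nth_take.
by move=> /nth_count_rung; case: (count _ _).
Qed.

Variables (tau : ET -> nat -> R) (dl t : R) (M K : nat) (a : seq (option ET)).
Hypothesis dl_ge0 : 0 <= dl.
Hypothesis tE : t = M%:R * dl.
Hypothesis tau_gt0 : forall e k, 0 < tau e k.
Hypothesis size_a : size a = (M + K)%N.
Hypothesis in_gap : forall e, in_gaps (tau e) (gap_sets dl 0 (ringing e a)).
Hypothesis few_rings : (count (@rung ET) a <= K)%N.
Hypothesis no_close : close_pairs K a = 0%N.
Hypothesis no_late : count (@rung ET) (drop M a) = 0%N.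

(** No edge rings more than [K] times, so the accumulated rounding is less than [K] bins. *)
Lemma ring_time_at i e : nth None a i = Some e ->
  [/\ exists n : nat, ring_time tau a i = \sum_(k < n.+1) tau e k,
      (i.+1%:R - K%:R) * dl < ring_time tau a i &
      ring_time tau a i <= i.+1%:R * dl].
Proof.
move=> ai; rewrite /ring_time ai.
have bi : nth false (ringing e a) i by rewrite nth_ringing ai.
have := ring_time_bounds (@in_gap e) bi; rewrite /= add0n => /andP[lb ub]; split=> //.
  have : (0 < count id (take i.+1 (ringing e a)))%N.
    rewrite -has_count; apply/(has_nthP false); exists i; last by rewrite nth_take.
    rewrite size_take; case: ifP => // /negbT; rewrite -leqNgt => _.
    by case: (ltnP i (size (ringing e a))) => // /(nth_default false); rewrite bi.
  by case: (count _ _) => // n _; exists n.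
apply: le_lt_trans lb; rewrite ler_wpM2r// lerD2l lerN2 ler_nat.
exact: leq_trans (count_take_ringing _ _ _) few_rings.
Qed.

Lemma ring_time_gt0_le i e : nth None a i = Some e -> 0 < ring_time tau a i <= t.
Proof.
move=> ai; have [[n E] _ ub] := ring_time_at ai; apply/andP; split.
  rewrite E big_ord_recl/= ltr_wpDr//; apply: sumr_ge0 => k _; exact/ltW/tau_gt0.
have iM : (i < M)%N.
  rewrite ltnNge; apply/negP => Mi; have := @nth_count_rung (drop M a) (i - M) e.
  by rewrite no_late nth_drop subnKC// => /(_ ai).
by rewrite tE (le_trans ub)// ler_wpM2r// ler_nat.
Qed.

(** Rings more than [K] bins apart cannot be exchanged by a rounding of less than [K] bins. *)
Lemma ring_time_lt i j e e' : (i < j)%N -> nth None a i = Some e ->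
  nth None a j = Some e' -> ring_time tau a i < ring_time tau a j.
Proof.
move=> ij ai aj; have ijK := close_pairs_lt no_close ij ai aj.
have [_ _ ub] := ring_time_at ai; have [_ lb _] := ring_time_at aj.
apply: le_lt_trans lb; apply: le_trans ub _; rewrite ler_wpM2r//.
by rewrite lerBrDr -natrD ler_nat addSn ltnW.
Qed.

(** The first unrecorded ring comes after bin [M + K] minus at most [K] bins of rounding, that is
    after [t]; the [K] extra bins serve this purpose. *)
Lemma ring_time_exists e (n : nat) : \sum_(k < n.+1) tau e k <= t ->
  exists2 i, nth None a i = Some e & \sum_(k < n.+1) tau e k = ring_time tau a i.
Proof.
move=> le_t; have [n_lt|n_ge] := ltnP n (count id (ringing e a)).
  have [i bi ci] := exists_nth_count n_lt; exists i.
    by apply/eqP; rewrite -nth_ringing.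
  by move: bi; rewrite nth_ringing /ring_time => /eqP ->; rewrite ci.
have /= := next_ring_time dl_ge0 (@in_gap e).
rewrite add0n size_map size_a => lb.
have := sum_pos_increasing (tau_gt0 e) (n_ge : ((count id (ringing e a)).+1 <= n.+1)%N).
move=> /(lt_le_trans lb) /lt_le_trans /(_ le_t); rewrite tE ltNge ler_wpM2r//.
rewrite lerBrDr -natrD ler_nat leq_add2l.
exact: leq_trans (count_ringing _ _) few_rings.
Qed.
End RingTimes.

(** * Probability of a pattern *)

Lemma prod_nth_default {R : realType} (T : Type) (F : T -> R) (x0 : T) (s : seq T)
    (n : nat) : F x0 = 1 -> (size s <= n)%N ->
  \prod_(k < n) F (nth x0 s k) = \prod_(x <- s) F x.
Proof.
move=> F1; elim: s n => [|x s IH] [|n] //=.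
- by rewrite big_ord0 big_nil.
- by rewrite big_nil big1// => k _; rewrite nth_nil.
- by rewrite ltnS => sn; rewrite big_ord_recl/= big_cons IH.
Qed.

Section FiniteProbability.
Context {R : realType} {d : measure_display} {Omega : measurableType d}
  (P : probability Omega R).

Lemma measurable_bigsetU_seq (I : Type) (L : seq I) (A : I -> set Omega) :
  (forall i, measurable (A i)) -> measurable (\big[setU/set0]_(i <- L) A i).
Proof. by move=> mA; apply: bigsetU_measurable. Qed.

Lemma probability_bigsetU_le (I : Type) (L : seq I) (A : I -> set Omega) :
  (forall i, measurable (A i)) ->
  (P (\big[setU/set0]_(i <- L) A i) <= \sum_(i <- L) P (A i))%E.
Proof.
move=> mA; elim: L => [|i L IH]; first by rewrite !big_nil measure0.
rewrite !big_cons; apply: le_trans (measureU2 _ _ _) _ => //.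
  exact: measurable_bigsetU_seq.
exact: leeD.
Qed.

Lemma probability_bigsetU (I : choiceType) (L : seq I) (A : I -> set Omega) :
  (forall i, measurable (A i)) -> uniq L ->
  (forall i j w, i \in L -> j \in L -> A i w -> A j w -> i = j) ->
  (P (\big[setU/set0]_(i <- L) A i) = \sum_(i <- L) P (A i))%E.
Proof.
move=> mA; elim: L => [|i L IH] /=; first by rewrite !big_nil measure0.
move=> /andP[iL UL] dis; rewrite !big_cons measureU//.
- congr (_ + _)%E; apply: IH => // j k w jL kL.
  by apply: dis; rewrite in_cons ?jL ?kL orbT.
- exact: measurable_bigsetU_seq.
- apply/seteqP; split => // w [Ai]; rewrite -bigcup_seq => -[j jL Aj].
  by move: iL; rewrite (dis i j w) ?in_cons ?eqxx ?[_ \in L]jL ?orbT.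
Qed.

Lemma independent_finType (I : Type) (X : I -> Omega -> R) (J : finType)
    (g : J -> I) (B : J -> set R) :
  mutually_independent P X -> injective g -> (forall j, measurable (B j)) ->
  P [set w | forall j, B j (X (g j) w)] = (\prod_j P (X (g j) @^-1` B j))%E.
Proof.
move=> ind ginj mB.
have := ind #|J| (fun i => g (enum_val i)) (fun i => B (enum_val i)).
move=> /(_ (inj_comp ginj (@enum_val_inj _ _))) /(_ (fun k => mB _)).
rewrite -(big_enum_val (fun j => P (X (g j) @^-1` B j)))/= => E.
rewrite [RHS](eq_bigl (mem J))// -E; congr (P _); apply/seteqP; split => w /= H.
  by move=> k _; exact: H.
by move=> j; have := H (enum_rank j) Logic.I; rewrite /= enum_rankK.
Qed.

Lemma probability_fineE (A : set Omega) : measurable A -> P A = (fine (P A))%:E.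
Proof. by move=> mA; rewrite fineK// fin_num_measure. Qed.

Lemma exponential_silent_gap (X : Omega -> R) (dl : R) (c : nat) :
  exponential1 P X -> 0 <= dl ->
  P (X @^-1` silent_gap dl c) = (expR (- (c%:R * dl)))%:E.
Proof.
move=> eX dl0; rewrite -eX ?mulr_ge0//; congr (P _).
by apply/seteqP; split => w /=; rewrite silent_gapE.
Qed.

Lemma exponential_ring_gap (X : Omega -> R) (dl : R) (c : nat) :
  measurable_fun setT X -> exponential1 P X -> 0 <= dl ->
  P (X @^-1` ring_gap dl c) =
    (expR (- (c%:R * dl)) - expR (- (c.+1%:R * dl)))%:E.
Proof.
move=> mX eX dl0.
have mp B : measurable B -> measurable (X @^-1` B).
  by move=> mB; rewrite -[_ @^-1` _]setTI; exact: mX.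
have : P (X @^-1` silent_gap dl c) =
    (P (X @^-1` ring_gap dl c) + P (X @^-1` silent_gap dl c.+1))%E.
  have dis : X @^-1` ring_gap dl c `&` X @^-1` silent_gap dl c.+1 = set0.
    apply/seteqP; split => // w [] /=; rewrite ring_gapE silent_gapE.
    by move=> /andP[_ h]; rewrite ltNge => /negP; apply.
  rewrite -measureU//; [|exact: (mp _ (measurable_itv _))|exact: (mp _ (measurable_itv _))].
  congr (P _); rewrite -preimage_setU; congr (_ @^-1` _).
  apply/seteqP; split => x; rewrite /setU/= ?silent_gapE ?ring_gapE.
    by move=> h; case: (leP x (c.+1%:R * dl)) => h'; [left; rewrite h|right].
  case=> [/andP[]//|]; apply: le_lt_trans.
  by rewrite ler_wpM2r// ler_nat.
rewrite !exponential_silent_gap// (probability_fineE (mp _ (measurable_itv _))).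
by rewrite -EFinD => -[->]; rewrite addrK.
Qed.
(** [exponential1] gives tails only, but these fix the probabilities of all intervals in [gap_sets];
    one variable can thus stand for every interarrival time. *)
Lemma exponential_gap_sets (X Y : Omega -> R) (dl : R) (c : nat) (b : seq bool)
    (k : nat) :
  measurable_fun setT X -> exponential1 P X ->
  measurable_fun setT Y -> exponential1 P Y -> 0 <= dl ->
  P (X @^-1` nth setT (gap_sets dl c b) k) =
  P (Y @^-1` nth setT (gap_sets dl c b) k).
Proof.
move=> mX eX mY eY dl0; elim: b c k => [|[] b IH] c k /=; last exact: IH.
  case: k => [|k] /=; first by rewrite !exponential_silent_gap.
  by rewrite nth_nil !preimage_setT.
by case: k => [|k] /=; [rewrite !exponential_ring_gap|exact: IH].
Qed.
End FiniteProbability.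

Section PatternProbability.
Context {R : realType} {d : measure_display} {Omega : measurableType d}
  (P : probability Omega R) {V E : Type} {VT ET J : finType}
  (iV : VT -> V) (iE : ET -> E) (tau : E -> nat -> Omega -> R)
  (f0 : V -> Omega -> R) (cell : J -> set R) (o : V) (dl : R).
Hypothesis iV_inj : injective iV.
Hypothesis iE_inj : injective iE.
Hypothesis dl_ge0 : 0 <= dl.
Hypothesis tau_meas : forall e k, measurable_fun setT (tau e k).
Hypothesis tau_exp : forall e k, exponential1 P (tau e k).
Hypothesis f0_meas : forall v, measurable_fun setT (f0 v).
Hypothesis f0_id : forall v v', identically_distributed P (f0 v) (f0 v').
Hypothesis indep : mutually_independent P
    (fun i : (E * nat) + V =>
       match i with inl (e, k) => tau e k | inr v => f0 v end).
Hypothesis cell_meas : forall j, measurable (cell j).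

Definition pattern_event (a : seq (option ET)) (x : {ffun VT -> J}) : set Omega :=
  [set w | (forall e, in_gaps (fun k => tau (iE e) k w)
                        (gap_sets dl 0 (ringing e a))) /\
           forall v, cell (x v) (f0 (iV v) w)].

(** The probabilities that in one bin no edge rings, and ([w_ring]) that one given edge rings and no
    other. *)
Definition w_silent : R := expR (- dl) ^+ #|ET|.
Definition w_ring : R := expR (- dl) ^+ #|ET| * (expR dl - 1).
Definition cell_prob (j : J) : R := fine (P (f0 o @^-1` cell j)).

(** A rectangular index set, with [(size a).+1] interarrival times per edge, suits the product rule;
    past the end of [gap_sets] the default [setT] imposes nothing. *)
Definition gap_family (a : seq (option ET)) (x : {ffun VT -> J})
    (i : (ET * 'I_(size a).+1) + VT) : set R :=
  match i with
  | inl (e, k) => nth setT (gap_sets dl 0 (ringing e a)) k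
  | inr v => cell (x v)
  end.

Definition index_map (n : nat) (i : (ET * 'I_n) + VT) : (E * nat) + V :=
  match i with inl (e, k) => inl (iE e, k : nat) | inr v => inr (iV v) end.

Definition coord (i : (E * nat) + V) : Omega -> R :=
  match i with inl (e, k) => tau e k | inr v => f0 v end.

Lemma measurable_gap_family a x i : measurable (@gap_family a x i).
Proof. by case: i => [[e k]|v] /=; [exact: measurable_gap_sets|]. Qed.

Lemma measurable_coord i : measurable_fun setT (coord i).
Proof. by case: i => [[e k]|v] /=. Qed.

Lemma pattern_eventE a x : pattern_event a x =
  [set w | forall i, @gap_family a x i (coord (index_map i) w)].
Proof.
apply/seteqP; split => w /=.
  move=> [He Hv] [[e k]|v] /=; last exact: Hv.
  have [kgs|kgs] := ltnP k (size (gap_sets dl 0 (ringing e a))); first exact: He.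
  by rewrite nth_default.
move=> H; split => [e k kgs|v]; last exact: (H (inr v)).
have ks : (k < (size a).+1)%N.
  apply: leq_trans kgs _; rewrite size_gap_sets ltnS.
  by apply: leq_trans (count_size _ _) _; rewrite size_map.
exact: (H (inl (e, Ordinal ks))).
Qed.

Lemma measurable_pattern_event a x : measurable (pattern_event a x).
Proof.
rewrite pattern_eventE.
rewrite (_ : [set w | _] = \bigcap_(i in [set: (ET * 'I_(size a).+1) + VT])
   (coord (index_map i) @^-1` @gap_family a x i)).
  apply: fin_bigcap_measurable; first exact: finite_finset.
  move=> i _; rewrite -[_ @^-1` _]setTI.
  by apply: measurable_coord => //; exact: measurable_gap_family.
by apply/seteqP; split => w /= H i; [move=> _; exact: H|exact: (H i)].
Qed.

(** The product over edges is regrouped bin by bin; a letter [Some e] contributes [e^dl - 1] in the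
    row of [e] only. *)
Lemma prod_weight (a : seq (option ET)) :
  \prod_e (\prod_(i <- ringing e a) (if i then expR dl - 1 else 1) *
       expR (- dl) ^+ size a) = weight w_silent w_ring a.
Proof.
rewrite /weight; elim: a => [|x a IH].
  by rewrite big_nil big1// => e _; rewrite big_nil expr0 mulr1.
rewrite big_cons -IH.
under eq_bigr do rewrite /= big_cons exprS mulrACA.
rewrite big_split/=; congr (_ * _); rewrite big_split/= prodr_const.
rewrite /w_silent /w_ring; case: x => [e|] /=; last by rewrite big1 ?mul1r.
rewrite (bigD1 e)//= eqxx big1 ?mulr1 1?mulrC// => e' /negPf e'e.
by rewrite (_ : Some e == Some e' = false)// -e'e eq_sym.
Qed.

Lemma pattern_probability a x : P (pattern_event a x) =
  (weight w_silent w_ring a * \prod_v cell_prob (x v))%:E.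
Proof.
rewrite pattern_eventE.
rewrite (independent_finType indep _ (@measurable_gap_family a x)); last first.
  move=> [[e k]|v] [[e' k']|v'] //= [].
    by move=> /iE_inj -> /val_inj ->.
  by move=> /iV_inj ->.
have mp i B : measurable B -> measurable (coord i @^-1` B).
  by move=> mB; rewrite -[_ @^-1` _]setTI; exact: measurable_coord.
have prE i B : measurable B -> P (coord i @^-1` B) = (fine (P (coord i @^-1` B)))%:E.
  by move=> mB; apply: probability_fineE; exact: mp.
rewrite (eq_bigr (fun i =>
    (fine (P (coord (index_map i) @^-1` @gap_family a x i)))%:E)); last first.
  by move=> i _; apply: prE; exact: measurable_gap_family.
rewrite prodEFin; congr (_%:E); rewrite big_sumType/=; congr (_ * _); last first.
  by apply: eq_bigr => v _; rewrite /cell_prob (f0_id (iV v) o).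
transitivity (\prod_e \prod_(k < (size a).+1)
  fine (P (tau (iE e) k @^-1` nth setT (gap_sets dl 0 (ringing e a)) k))).
  by rewrite pair_bigA/=; apply: eq_bigr => -[].
rewrite -prod_weight; apply: eq_bigr => e _.
have mu1 : fine (P (tau (iE e) 0 @^-1` setT)) = 1 by rewrite preimage_setT probability_setT.
rewrite (eq_bigr (fun k : 'I_(size a).+1 =>
  fine (P (tau (iE e) 0 @^-1` nth setT (gap_sets dl 0 (ringing e a)) k)))); last first.
  by move=> k _; congr fine; exact: exponential_gap_sets.
rewrite (prod_nth_default (F := fun A => fine (P (tau (iE e) 0 @^-1` A))))//; last first.
  rewrite size_gap_sets ltnS; apply: leq_trans (count_size _ _) _.
  by rewrite size_map.
rewrite (prod_gap_sets (dl := dl) (mu := fun A => fine (P (tau (iE e) 0 @^-1` A)))).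
- by rewrite mul0r oppr0 expR0 mul1r size_map.
- by move=> c; rewrite exponential_silent_gap.
- by move=> c; rewrite exponential_ring_gap.
Qed.
End PatternProbability.

Lemma ringing_inj {ET : finType} (a a' : seq (option ET)) :
  size a = size a' -> (forall e, ringing e a = ringing e a') -> a = a'.
Proof.
move=> sa H; apply: (@eq_from_nth _ None) => // i _.
have Hi e : (nth None a i == Some e) = (nth None a' i == Some e).
  by rewrite -!nth_ringing H.
case E : (nth None a i) => [e|]; first by have := Hi e; rewrite E eqxx => /esym/eqP.
by case E' : (nth None a' i) => [e|] //; have := Hi e; rewrite E E' eqxx.
Qed.

(** * Union bound over patterns *)

Section EventBound.
Context {R : realType} {d : measure_display} {Omega : measurableType d}
  (P : probability Omega R) {V E : Type} {VT ET J : finType}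
  (iV : VT -> V) (iE : ET -> E) (tau : E -> nat -> Omega -> R)
  (f0 : V -> Omega -> R) (cell : J -> set R) (o : V) (dl : R).
Hypothesis iV_inj : injective iV.
Hypothesis iE_inj : injective iE.
Hypothesis dl_ge0 : 0 <= dl.
Hypothesis tau_meas : forall e k, measurable_fun setT (tau e k).
Hypothesis tau_exp : forall e k, exponential1 P (tau e k).
Hypothesis f0_meas : forall v, measurable_fun setT (f0 v).
Hypothesis f0_id : forall v v', identically_distributed P (f0 v) (f0 v').
Hypothesis indep : mutually_independent P
    (fun i : (E * nat) + V =>
       match i with inl (e, k) => tau e k | inr v => f0 v end).
Hypothesis cell_meas : forall j, measurable (cell j).
Hypothesis cell_cover : forall v w, exists j, cell j (f0 v w).
Hypothesis cell_disj : forall j j' z, cell j z -> cell j' z -> j = j'.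

Let nu := cell_prob P f0 cell o.
Let G := pattern_event iV iE tau f0 cell dl.

Lemma cell_prob_ge0 j : 0 <= cell_prob P f0 cell o j.
Proof. exact: fine_ge0. Qed.

Lemma sum_cell_prob : \sum_j cell_prob P f0 cell o j = 1.
Proof.
have mp j : measurable (f0 o @^-1` cell j).
  by rewrite -[_ @^-1` _]setTI; exact: f0_meas.
apply: EFin_inj; rewrite -sumEFin.
under eq_bigr do rewrite -(probability_fineE P (mp _)).
rewrite -big_enum -(probability_bigsetU P mp (enum_uniq _)); last first.
  by move=> j j' w _ _; exact: cell_disj.
rewrite -(probability_setT P); congr (P _); apply/seteqP; split => // w _.
rewrite -bigcup_seq; have [j wj] := cell_cover o w.
by exists j => //=; rewrite mem_enum.
Qed.

Lemma pattern_event_inj a a' x x' w : size a = size a' ->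
  G a x w -> G a' x' w -> a = a' /\ x = x'.
Proof.
move=> sa [Ha Hx] [Ha' Hx']; split.
  apply: ringing_inj => // e; apply: gap_sets_inj (Ha e) (Ha' e) => //.
  by rewrite !size_map.
by apply/ffunP => v; exact: cell_disj (Hx v) (Hx' v).
Qed.

(** The pattern events are disjoint, so their union misses exactly [1 - wsum 1] of the probability.
    Outside [Z], the event [Ev] lies in the missed part or in a bad pattern. *)
Lemma event_bound (Ev Z : set Omega) (N : nat)
    (bad : seq (option ET) -> {ffun VT -> J} -> bool) :
  measurable Ev -> measurable Z -> P Z = 0%E ->
  (forall w a x, size a = N -> Ev w -> ~ Z w -> G a x w -> bad a x) ->
  (P Ev <= (1 - wsum (@w_silent R ET dl) (@w_ring R ET dl) N (fun _ : seq (option ET) => 1) +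
            wsum (@w_silent R ET dl) (@w_ring R ET dl) N
              (fun a => \sum_(x : {ffun VT -> J}) (\prod_v nu (x v)) * (bad a x)%:R))%:E)%E.
Proof.
move=> mEv mZ Z0 Hbad.
pose L := [seq (a, x) | a <- @patterns ET N, x <- enum {ffun VT -> J}].
pose A (p : seq (option ET) * {ffun VT -> J}) := G p.1 p.2.
have mA p : measurable (A p) by exact: measurable_pattern_event.
have PA p : P (A p) = (weight (@w_silent R ET dl) (@w_ring R ET dl) p.1 *
    \prod_v nu (p.2 v))%:E by exact: pattern_probability.
have UL : uniq L.
  apply: allpairs_uniq; [exact: uniq_patterns|exact: enum_uniq|].
  by move=> [? ?] [? ?] _ _ /= [-> ->].
have sizeL p : p \in L -> size p.1 = N.
  by case/allpairsP => -[a x] /= [/size_patterns aN _ ->].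
pose U := \big[setU/set0]_(p <- L) A p.
have mU : measurable U by exact: measurable_bigsetU_seq.
have PU : P U = (wsum (@w_silent R ET dl) (@w_ring R ET dl) N (fun _ : seq (option ET) => 1))%:E.
  rewrite probability_bigsetU//; last first.
    move=> [a x] [a' x'] w /sizeL/= aN /sizeL/= aN' H H'.
    by have [|/= -> ->] := pattern_event_inj _ H H'; rewrite /= ?aN.
  under eq_bigr do rewrite PA.
  rewrite sumEFin big_allpairs_dep; congr (_%:E); apply: eq_bigr => a _ /=.
  rewrite -mulr_sumr big_enum/= -(bigA_distr_bigA (fun _ => nu)).
  by rewrite big1// => v _; exact: sum_cell_prob.
pose Lb := [seq p <- L | bad p.1 p.2].
pose UB := \big[setU/set0]_(p <- Lb) A p.
have mUB : measurable UB by exact: measurable_bigsetU_seq.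
have sub : Ev `<=` Z `|` (~` U `|` UB).
  move=> w Ew; have [|Zw] := pselect (Z w); first by left.
  right; have [Uw|] := pselect (U w); last by left.
  right; move: Uw; rewrite /U /UB -!bigcup_seq => -[[a x] /= ax Aax].
  exists (a, x) => //=; rewrite mem_filter ax andbT /=.
  exact: Hbad (sizeL _ ax) Ew Zw Aax.
have mCU : measurable (~` U) by exact: measurableC.
have mV : measurable (~` U `|` UB) by exact: measurableU.
have h0 : (P Ev <= P (Z `|` (~` U `|` UB)))%E.
  by apply: le_measure => //; rewrite inE//; exact: measurableU.
have h1 : (P (Z `|` (~` U `|` UB)) <= P Z + P (~` U `|` UB))%E.
  exact: measureU2.
have h2 : (P (~` U `|` UB) <= P (~` U) + P UB)%E by exact: measureU2.
rewrite Z0 add0e in h1; apply: le_trans h0 (le_trans h1 (le_trans h2 _)).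
rewrite probability_setC// PU EFinD; apply: leeD => //.
apply: le_trans (probability_bigsetU_le P Lb mA) _.
rewrite /Lb big_filter; under eq_bigr do rewrite PA.
rewrite sumEFin lee_fin big_mkcond big_allpairs_dep/=.
rewrite le_eqVlt; apply/orP; left; apply/eqP; apply: eq_bigr => a _.
rewrite big_enum/= mulr_sumr; apply: eq_bigr => x _.
by case: (bad a x); rewrite ?mulr1 ?mulr0.
Qed.
End EventBound.

(** * Finite windows of the graph *)

(* [rk] is the distance to the centre; edges that do not meet the open ball
   [rk < r] may be missing from the window. *)
Record window {V E : Type} {VT ET : finType} (ends : E -> V * V) (o : V)
    (r D : nat) (iV : VT -> V) (iE : ET -> E) (en : ET -> VT * VT)
    (rk : VT -> nat) (c : VT) : Prop := Window {
  window_iV_inj : injective iV;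
  window_iE_inj : injective iE;
  window_ends : forall e, ends (iE e) = (iV (en e).1, iV (en e).2);
  window_loopless : forall e, (en e).1 != (en e).2;
  window_center : iV c = o;
  window_rk0 : rk c = 0%N;
  window_rk12 : forall e, (rk (en e).1 <= (rk (en e).2).+1)%N;
  window_rk21 : forall e, (rk (en e).2 <= (rk (en e).1).+1)%N;
  window_interior : forall v, (rk v < r)%N -> forall e, incident ends e (iV v) ->
    exists e', e = iE e';
  window_degree : forall v,
    (#|[set e | ((en e).1 == v) || ((en e).2 == v)]%SET| <= D)%N
}.

Section Balls.
Context {V E : choiceType} (ends : E -> V * V) (o : V).

Definition reachable (n : nat) (v : V) : Prop := exists p : nat -> V,
  [/\ p 0%N = o, p n = v & forall i, (i < n)%N -> Defs.adjacent ends (p i) (p i.+1)].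

Hypothesis conn : connected_graph ends.

Lemma reachable_ex v : exists n, `[< reachable n v >].
Proof. by have [n [p Hp]] := conn o v; exists n; apply/asboolP; exists p. Qed.

Definition gdist v := ex_minn (reachable_ex v).

Lemma gdist_reach v : reachable (gdist v) v.
Proof. by rewrite /gdist; case: ex_minnP => n /asboolP. Qed.

Lemma gdist_min v n : reachable n v -> (gdist v <= n)%N.
Proof. by rewrite /gdist; case: ex_minnP => m _ H /asboolP; exact: H. Qed.

Lemma adjacent_sym u v : Defs.adjacent ends u v -> Defs.adjacent ends v u.
Proof. by case=> e H; exists e; case: H; [right|left]. Qed.

Lemma adjacent_ends e : Defs.adjacent ends (ends e).1 (ends e).2.
Proof. by exists e; left; rewrite -surjective_pairing. Qed.

Lemma gdist_center : gdist o = 0%N.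
Proof. by apply/eqP; rewrite -leqn0; apply: gdist_min; exists (fun=> o). Qed.

Lemma gdist_adj u v : Defs.adjacent ends u v -> (gdist v <= (gdist u).+1)%N.
Proof.
move=> uv; have [p [p0 pn pS]] := gdist_reach u; apply: gdist_min.
exists (fun i => if (i <= gdist u)%N then p i else v); split => //.
  by rewrite ltnn.
move=> i; rewrite ltnS leq_eqVlt => /predU1P[->|iu] /=.
  by rewrite eqxx ltnn pn.
by rewrite iu orbT; exact: pS.
Qed.

Variable D : nat.
Hypothesis degD : forall (v : V) (n : nat) (g : 'I_n -> E),
    injective g -> (forall k, incident ends (g k) v) -> (n <= D)%N.

Lemma finite_incident v : finite_set [set e | incident ends e v].
Proof.
apply: contrapT => /(infinite_set_fset D.+1)[X sub cX].
have : (#|` X| <= D)%N.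
  rewrite cardfE; apply: (degD (v := v) (g := fun k => fsval (enum_val k))).
    by move=> k k' /val_inj /enum_val_inj.
  by move=> k; apply: sub; exact: fsvalP.
by rewrite leqNgt cX.
Qed.

Lemma finite_edges (A : set V) : finite_set A ->
  finite_set [set e | exists2 v, A v & incident ends e v].
Proof.
move=> fA; rewrite (_ : [set e | _] = \bigcup_(v in A) [set e | incident ends e v]).
  by apply: bigcup_finite => // v _; exact: finite_incident.
by apply/seteqP; split => e /= [v Av ev]; exists v.
Qed.

Lemma finite_ball k : finite_set [set v | (gdist v <= k)%N].
Proof.
elim: k => [|k IH].
  apply: sub_finite_set (finite_set1 o) => v /=; rewrite leqn0 => /eqP v0.
  by have [p [p0 + _]] := gdist_reach v; rewrite v0 p0 => ->.
have fE := finite_edges IH; set Ed := [set e | _] in fE.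
apply: (@sub_finite_set _ _ ([set v | (gdist v <= k)%N] `|`
   ((fun e => (ends e).1) @` Ed `|` (fun e => (ends e).2) @` Ed))); last first.
  by rewrite !finite_setU; split => //; split; exact: finite_image.
move=> v /=; rewrite leq_eqVlt => /orP[/eqP vk|vk]; last by left.
right; have [p [p0 pn pS]] := gdist_reach v; rewrite vk in pn pS.
have kb : (gdist (p k) <= k)%N.
  by apply: gdist_min; exists p; split => // i ik; apply: pS; exact: leqW.
have [e He] := pS k (ltnSn k); rewrite pn in He.
have Ee : Ed e.
  by exists (p k) => //; case: He => H; [left|right]; rewrite H.
by case: He => H; [right|left]; exists e => //; rewrite H.
Qed.

Hypothesis simp : simple_graph ends.

(** Vertices are those of the closed ball of radius [r], edges those meeting the open ball; their
    other ends are then at distance at most [r]. *)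
Lemma window_exists (r : nat) :
  exists (VT ET : finType) (iV : VT -> V) (iE : ET -> E) (en : ET -> VT * VT)
    (rk : VT -> nat) (c : VT), window ends o r D iV iE en rk c.
Proof.
have [X XE] := finite_fsetP.1 (finite_ball r).
have fE : finite_set [set e | exists2 v, (gdist v < r)%N & incident ends e v].
  apply: finite_edges; apply: sub_finite_set (finite_ball r) => v /=; exact: ltnW.
have [Y YE] := finite_fsetP.1 fE.
have inX v : (v \in X) = (gdist v <= r)%N.
  apply/idP/idP => [vX|vr]; first by have : [set` X] v by []; rewrite -XE.
  by have : [set v | (gdist v <= r)%N] v by []; rewrite XE.
have inY e : (e \in Y) <-> exists2 v, (gdist v < r)%N & incident ends e v.
  split=> [eY|ev]; first by have : [set` Y] e by []; rewrite -YE.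
  have : [set e | exists2 v, (gdist v < r)%N & incident ends e v] e by [].
  by rewrite YE.
have oX : o \in X by rewrite inX gdist_center.
pose c : X := [` oX]%fset.
have endX (e : Y) : ((ends (val e)).1 \in X) && ((ends (val e)).2 \in X).
  have [v vr [] ve] := (inY (val e)).1 (fsvalP e); rewrite !inX -ve in vr *.
    by rewrite (ltnW vr)/= (leq_trans (gdist_adj (adjacent_ends _))).
  rewrite (ltnW vr) andbT.
  by rewrite (leq_trans (gdist_adj (adjacent_sym (adjacent_ends _)))).
(* By [endX] the default [c] of [insubd] is never taken. *)
pose en (e : Y) : X * X := (insubd c (ends (val e)).1, insubd c (ends (val e)).2).
have en1 e : val (en e).1 = (ends (val e)).1.
  by rewrite val_insubd; have /andP[-> _] := endX e.
have en2 e : val (en e).2 = (ends (val e)).2.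
  by rewrite val_insubd; have /andP[_ ->] := endX e.
exists X, Y, val, val, en, (fun v => gdist (val v)), c; split.
- exact: val_inj.
- exact: val_inj.
- by move=> e; rewrite en1 en2 -surjective_pairing.
- move=> e; apply/eqP => /(congr1 val); rewrite en1 en2; exact: simp.1.
- by [].
- exact: gdist_center.
- move=> e; rewrite en1 en2; apply: gdist_adj; apply: adjacent_sym.
  exact: adjacent_ends.
- by move=> e; rewrite en1 en2; apply: gdist_adj; exact: adjacent_ends.
- move=> v vr e ev; have eY : e \in Y by apply/inY; exists (val v).
  by exists [` eY]%fset.
- move=> v; apply: (degD (v := val v) (g := fun k => val (enum_val k))).
    by move=> k k' /val_inj /enum_val_inj.
  move=> k; have := enum_valP k; move: (enum_val k) => e; rewrite inE => /orP[] /eqP <-.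
    by left; rewrite en1.
  by right; rewrite en2.
Qed.

(** A walk in the whole graph from [H] to [z] must leave [H]. The edge of that step meets the open
    ball, so it belongs to the window even if [z] does not. *)
Lemma window_boundary {VT ET : finType} (r : nat) (iV : VT -> V) (iE : ET -> E)
    (en : ET -> VT * VT) (rk : VT -> nat) (c : VT) (H : {set VT}) (z : V) :
  window ends o r D iV iE en rk c -> H != finset.set0 ->
  H \subset [set v | (rk v < r)%N]%SET -> (forall v, v \in H -> iV v != z) ->
  exists e, ((en e).1 \in H) != ((en e).2 \in H).
Proof.
move=> W /set0Pn[u uH] HB zH.
have [n [p [p0 pn pS]]] := conn (iV u) z.
pose inH x := exists2 v, v \in H & iV v = x.
have [i ii iN] : exists2 i, (i < n)%N & inH (p i) /\ ~ inH (p i.+1).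
  apply: contrapT => Hn.
  have all i : (i <= n)%N -> inH (p i).
    elim: i => [_|i IH ilt]; first by exists u.
    apply: contrapT => Ni; apply: Hn; exists i => //; split => //.
    exact/IH/ltnW.
  by have [v vH] := all n (leqnn n); rewrite pn => /eqP; rewrite (negPf (zH v vH)).
case: iN => -[x xH xp] yN; have [e He] := pS i ii.
have xr : (rk x < r)%N by have := fintype.subsetP HB x xH; rewrite inE.
have [e' eE] : exists e', e = iE e'.
  apply: (window_interior W xr); rewrite xp.
  by rewrite /incident; case: He => ->; [left|right].
exists e'; subst e; rewrite (window_ends W) -xp in He.
have iN v : iV v = p i.+1 -> v \notin H.
  by move=> vp; apply/negP => vH; apply: yN; exists v.
case: He => -[] h1 h2.
  by rewrite (window_iV_inj W h1) xH (negPf (iN _ h2)).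
by rewrite (window_iV_inj W h2) xH (negPf (iN _ h1)).
Qed.
End Balls.

(** * The truncated time *)

Section Tstar.
Context {R : realType}.

Lemma tstar_le (V : Type) (t : R) : tstar V t <= t.
Proof. by rewrite /tstar; case: pselect => // ?; rewrite ge_min lexx. Qed.

Lemma tstar_ge0 (V : Type) (t : R) : 0 <= t -> 0 <= tstar V t.
Proof.
by move=> t0; rewrite /tstar; case: pselect => // ?; rewrite le_min t0 sqr_ge0.
Qed.

(** If [H] covered [V], then [V] would be finite and [sqrt t_* <= |V| <= #|H|]. *)
Lemma tstar_outside (V : Type) (VT : finType) (iV : VT -> V) (H : {set VT}) (t : R) :
  injective iV -> #|H|%:R < Num.sqrt (tstar V t) ->
  exists z, forall v, v \in H -> iV v <> z.
Proof.
move=> iV_inj Hlt; apply: contrapT => Hz.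
have surj z : exists k : 'I_#|H|, iV (enum_val k) = z.
  have [v vH vz] : exists2 v, v \in H & iV v = z.
    apply: contrapT => Nv; apply: Hz; exists z => v vH vz; apply: Nv.
    by exists v.
  by exists (enum_rank_in vH v); rewrite enum_rankK_in.
have [g gK] := choice surj.
move: Hlt; rewrite ltNge => /negP; apply; rewrite /tstar; case: pselect; last first.
  case; exists #|H|, (fun k => iV (enum_val k)); exists g => // k.
  by apply: enum_val_inj; apply: iV_inj; rewrite gK.
move=> pf; case: (cid pf) => n [h h_bij] /=.
have nH : (n <= #|H|)%N.
  rewrite -(card_ord n) -(card_ord #|H|); apply: (leq_card (g \o h)).
  apply: inj_comp (bij_inj h_bij).
  by apply: (@can_inj _ _ g (fun k => iV (enum_val k))) => z; exact: gK.
apply: (@le_trans _ _ n%:R); last by rewrite ler_nat.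
rewrite -[leRHS]ger0_norm// -sqrtr_sqr; apply: ler_wsqrtr.
by rewrite ge_min lexx orbT.
Qed.
End Tstar.

(** The sum is the mean of [Y], which is [X] replaced by the base point of its cell, and
    [0 <= X - Y <= eta] pointwise. *)
Lemma mean_discretisation {R : realType} {d : measure_display}
    {Omega : measurableType d} (P : probability Omega R) (J : finType)
    (X : Omega -> R) (cell : J -> set R) (y : J -> R) (eta : R) :
  measurable_fun setT X -> (forall w, -1 <= X w <= 1) ->
  (forall j, measurable (cell j)) ->
  (forall w, exists j, cell j (X w)) ->
  (forall j j' z, cell j z -> cell j' z -> j = j') ->
  (forall j z, cell j z -> y j <= z <= y j + eta) ->
  0 <= fine ('E_P[X]) - \sum_j fine (P (X @^-1` cell j)) * y j <= eta.
Proof.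
move=> mX X1 mcell cover disj ycell; set m := \sum_j _.
have mA j : measurable (X @^-1` cell j) by rewrite -[_ @^-1` _]setTI; exact: mX.
have L1 (f : Omega -> R) (C : R) : measurable_fun setT f ->
    (forall w, `|f w| <= C) -> f \in Lfun P 1.
  move=> mf fC; apply/Lfun1_integrable/measurable_bounded_integrable => //.
    have := probability_setT P => /= ->; exact: ltry.
  exists C; split; first exact: num_real.
  by move=> x Cx w _ /=; apply: le_trans (fC w) (ltW Cx).
have XL : X \in Lfun P 1.
  by apply: (L1 _ 1) => // w; rewrite ler_norml X1.
have indL j : (\1_(X @^-1` cell j) : Omega -> R) \in Lfun P 1.
  apply: (L1 _ 1); first exact: measurable_indic.
  by move=> w; rewrite indicE; case: (_ \in _); rewrite ?normr1 ?normr0.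
pose F j : Omega -> R := y j \o* \1_(X @^-1` cell j).
have FL j : F j \in Lfun P 1.
  apply: (L1 _ `|y j|) => [|w].
    by apply: measurable_funM => //; exact: measurable_indic.
  rewrite /F /= indicE normrM; case: (_ \in _); rewrite ?normr1 ?normr0 ?mul1r//.
  by rewrite mul0r.
pose Y : Omega -> R := \sum_(f <- [seq F j | j <- enum J]) f.
have YL : Y \in Lfun P 1.
  by rewrite /Y big_seq rpred_sum// => f /mapP[j _ ->].
have YE w j : cell j (X w) -> Y w = y j.
  move=> wj; rewrite /Y big_map big_enum/= fct_sumE (bigD1 j)//= big1 ?addr0.
    by rewrite /F /= indicE mem_set// mul1r.
  move=> j' j'j; rewrite /F /= indicE memNset ?mul0r// => wj'.
  by move: j'j; rewrite (disj _ _ _ wj' wj) eqxx.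
have EY : ('E_P[Y] = m%:E)%E.
  rewrite /Y expectation_sum; last by move=> f /mapP[j _ ->].
  rewrite big_map big_enum/= /m -sumEFin; apply: eq_bigr => j _.
  rewrite expectationZl// expectation_indic// mulrC EFinM; congr (_ * _)%E.
  exact: probability_fineE.
have XY w : 0 <= X w - Y w <= eta.
  have [j wj] := cover w; rewrite (YE w j wj).
  by have := ycell _ _ wj; lra.
have EXY : ('E_P[(X \- Y)%R] = 'E_P[X] - m%:E)%E by rewrite expectationB// EY.
have mXY : measurable_fun setT (X \- Y).
  apply: measurable_funB => //.
  by apply/measurable_EFinP; move/Lfun1_integrable: YL => /measurable_int.
have h1 : (0 <= 'E_P[(X \- Y)%R])%E.
  by apply: expectation_ge0 => w /=; have /andP[] := XY w.
have h2 : ('E_P[(X \- Y)%R] <= eta%:E)%E.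
  rewrite -(expectation_cst P eta); apply: expectation_le => //.
  - by move=> w /=; have /andP[] := XY w.
  - by move=> w /=; have /andP[h0 he] := XY w; exact: le_trans h0 he.
  - by apply: aeW => w /=; have /andP[] := XY w.
move: h1 h2; rewrite EXY -(fineK (expectation_fin_num XL)) -EFinB !lee_fin.
by move=> -> ->.
Qed.

(** * Assembling the bound *)

Lemma expR_le1D2x {R : realType} (x : R) : 0 <= x -> x <= 1 / 2 ->
  expR x <= 1 + 2 * x.
Proof.
move=> x0 x2; have h := expR_ge1Dx (- x); have e0 := expR_gt0 x.
have : (1 + - x) * expR x <= 1.
  by have := ler_wpM2r (ltW e0) h; rewrite [expR (- x) * _]mulrC expRxMexpNx_1.
move=> h1; have d0 : 0 < 1 - x by lra.
rewrite -(ler_pM2r d0).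
have : 0 <= x * (1 / 2 - x) by rewrite mulr_ge0// subr_ge0.
by move: h1; set e := expR x; lra.
Qed.

(** * Estimates for the bin weights *)

Section Weights.
Context {R : realType} (ET : finType) (dl : R).
Hypothesis dl_ge0 : 0 <= dl.
Let f : R := #|ET|%:R.
Let w0 := @w_silent R ET dl.
Let w1 := @w_ring R ET dl.

Lemma bernoulli_ge (x : R) (n : nat) : -1 <= x -> 1 + n%:R * x <= (1 + x) ^+ n.
Proof.
move=> x1; elim: n => [|n IH]; first by rewrite mul0r addr0 expr0.
have x1' : 0 <= 1 + x by lra.
rewrite exprS; apply: le_trans (ler_wpM2l x1' IH).
have : 0 <= n%:R * x ^+ 2 by rewrite mulr_ge0// sqr_ge0.
rewrite -natr1; lra.
Qed.

Lemma w_silentE : w0 = expR (- (f * dl)).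
Proof. by rewrite /w0 /w_silent -expRM_natl mulrN. Qed.

Lemma w_ringE : w1 = w0 * (expR dl - 1).
Proof. by []. Qed.

Lemma expR_sub1_ge0 : 0 <= expR dl - 1.
Proof. by rewrite subr_ge0 -expR0 ler_expR. Qed.

Lemma w_silent_ge0 : 0 <= w0.
Proof. by rewrite w_silentE expR_ge0. Qed.

Lemma w_ring_ge0 : 0 <= w1.
Proof. by rewrite w_ringE mulr_ge0// ?w_silent_ge0 ?expR_sub1_ge0. Qed.

(** Multiplied by [e^(f dl)], this is Bernoulli's inequality [1 + f (e^dl - 1) <= (e^dl)^f]. *)
Lemma weights_le1 : w0 + f * w1 <= 1.
Proof.
rewrite w_ringE mulrCA -[X in X + _]mulr1 -mulrDr w_silentE expRN.
rewrite ler_pdivrMl ?expR_gt0// mulr1 expRM_natl.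
have -> : expR dl = 1 + (expR dl - 1) by ring.
rewrite [1 + (expR dl - 1) - 1]addrAC subrr add0r.
by apply: bernoulli_ge; have := expR_sub1_ge0; lra.
Qed.

Lemma w_ring_le : dl <= 1 / 2 -> w1 <= 2 * dl.
Proof.
move=> dl2; rewrite w_ringE; apply: (@le_trans _ _ (expR dl - 1)).
  rewrite ler_piMl ?expR_sub1_ge0// w_silentE -expR0 ler_expR oppr_le0.
  by rewrite mulr_ge0// /f ler0n.
by have := expR_le1D2x dl_ge0 dl2; lra.
Qed.

Lemma w_ring_ge : f * dl <= 1 / 2 -> dl / 2 <= w1.
Proof.
move=> fdl; rewrite w_ringE w_silentE.
have h := expR_ge1Dx (- (f * dl)); have h' := expR_ge1Dx dl.
apply: (@le_trans _ _ ((1 / 2) * dl)); first by lra.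
by apply: ler_pM => //; lra.
Qed.

(** The weight lost per bin, to multiple rings, is of second order:
    [e^-x (1 + x) >= (1 - x) (1 + x)] with [x = f dl]. *)
Lemma total_weight_ge (N : nat) : f * dl <= 1 / 2 ->
  1 - N%:R * (f * dl) ^+ 2 <= (w0 + f * w1) ^+ N.
Proof.
move=> fdl; have f0 : 0 <= f * dl by rewrite mulr_ge0// /f ler0n.
have h : 1 - (f * dl) ^+ 2 <= w0 + f * w1.
  rewrite w_ringE mulrCA -[X in _ <= X + _]mulr1 -mulrDr w_silentE.
  have := expR_ge1Dx (- (f * dl)); have h' := expR_ge1Dx dl => h1.
  have h2 : 1 + f * dl <= 1 + f * (expR dl - 1).
    by rewrite lerD2l; apply: ler_wpM2l; [rewrite /f ler0n|lra].
  have -> : 1 - (f * dl) ^+ 2 = (1 + - (f * dl)) * (1 + f * dl) by ring.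
  by apply: ler_pM => //; lra.
have u1 : (f * dl) ^+ 2 <= 1 by rewrite exprn_ile1//; lra.
apply: le_trans (_ : (1 + - (f * dl) ^+ 2) ^+ N <= _).
  by rewrite -mulrN; apply: bernoulli_ge; lra.
have h0 : 0 <= 1 - (f * dl) ^+ 2 by rewrite subr_ge0.
by apply: lerXn2r (h); rewrite nnegrE//; exact: le_trans h.
Qed.
End Weights.

(** * Cells for the initial opinions *)

Section Cells.
Context {R : realType} (L : nat).

(** The cells are half-open, so the value 1 needs a cell of its own beyond the first [L]. *)
Definition cell_base (j : 'I_L.+1) : R := -1 + j%:R * (2 / L%:R).
Definition grid_cell (j : 'I_L.+1) : set R :=
  `[cell_base j, (cell_base j + 2 / L%:R)[%classic.

Hypothesis L_gt0 : (0 < L)%N.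
Let eta_gt0 : 0 < 2 / L%:R :> R.
Proof. by rewrite divr_gt0// ltr0n. Qed.

Lemma grid_cellE j z :
  grid_cell j z = (cell_base j <= z < cell_base j + 2 / L%:R) :> Prop.
Proof. by rewrite /grid_cell /= in_itv. Qed.

Lemma cell_base_bound j : -1 <= cell_base j <= 1.
Proof.
have j0 : 0 <= j%:R * (2 / L%:R) :> R by rewrite mulr_ge0// ltW.
have jL : j%:R * (2 / L%:R) <= L%:R * (2 / L%:R) :> R.
  by rewrite ler_wpM2r ?(ltW eta_gt0)// ler_nat -ltnS.
have : L%:R * (2 / L%:R) = 2 :> R by rewrite mulrC divfK// pnatr_eq0 -lt0n.
by rewrite /cell_base; lra.
Qed.

Lemma grid_cell_cover z : -1 <= z <= 1 -> exists j, grid_cell j z.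
Proof.
move=> /andP[z1 z2]; pose u := (z + 1) / (2 / L%:R).
have u0 : 0 <= u by apply: divr_ge0 (ltW eta_gt0); lra.
have /andP[ul uu] := truncn_itv u0.
have uz : u * (2 / L%:R) = z + 1 by rewrite divfK// gt_eqF.
have jL : (Num.truncn u < L.+1)%N.
  rewrite ltnS -(ler_nat R); apply: le_trans ul _.
  rewrite /u ler_pdivrMr// mulrCA divff ?mulr1; last by rewrite pnatr_eq0 -lt0n.
  by lra.
exists (Ordinal jL); rewrite grid_cellE /cell_base /=.
have := ler_wpM2r (ltW eta_gt0) ul; rewrite uz => h1.
have : u * (2 / L%:R) < (Num.truncn u).+1%:R * (2 / L%:R) by rewrite ltr_pM2r.
by rewrite uz -natr1; move: h1; clear; lra.
Qed.

Lemma grid_cell_disj j j' z : grid_cell j z -> grid_cell j' z -> j = j'.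
Proof.
have lt_false (i i' : 'I_L.+1) : grid_cell i z -> grid_cell i' z -> (i < i')%N -> False.
  rewrite !grid_cellE => /andP[_ h] /andP[h' _] ii'.
  have : (i.+1)%:R * (2 / L%:R) <= i'%:R * (2 / L%:R) :> R.
    by rewrite ler_wpM2r ?(ltW eta_gt0)// ler_nat.
  by move: h h'; rewrite /cell_base -natr1; lra.
move=> h h'; apply/val_inj/eqP; rewrite eqn_leq; apply/andP.
by split; rewrite leqNgt; apply/negP => /lt_false; apply.
Qed.
End Cells.

Lemma exponential_gt0_ae {R : realType} {d : measure_display}
    {Omega : measurableType d} (P : probability Omega R) (X : Omega -> R) :
  measurable_fun setT X -> exponential1 P X -> {ae P, forall w, 0 < X w}.
Proof.
move=> mX eX; have mA : measurable [set w | 0 < X w].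
  have -> : [set w | 0 < X w] = X @^-1` `]0, +oo[%classic.
    by apply/seteqP; split => w /=; rewrite in_itv/= andbT.
  by rewrite -[_ @^-1` _]setTI; apply: mX => //; exact: measurable_itv.
exists (~` [set w | 0 < X w]); split => //; first exact: measurableC.
by rewrite probability_setC// eX// oppr0 expR0 subee.
Qed.

(** Used with [s = S] and [u = t]: [s^2 / 36] is [q^-2] for [q = 6 / S], and [u / 18] is the decay
    up to time [t]. The remaining [- s^2 / 36] is below [- s / 12] once [s >= 3]. *)
Lemma square_rate_le {R : realType} (s u : R) : 6 <= s -> s ^+ 2 <= u ->
  s ^+ 2 / 36 + - (u / 18) <= - (s / 12).
Proof.
move=> s6 su; have : 0 <= s * (s - 3) by rewrite mulr_ge0//; lra.
by move: su; rewrite expr2; lra.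
Qed.

Lemma lerD6 {R : realType} (a a1 a2 a3 a4 a5 a6 b1 b2 b3 b4 b5 b6 : R) :
  a1 <= b1 -> a2 <= b2 -> a3 <= b3 -> a4 <= b4 -> a5 <= b5 -> a6 <= b6 ->
  a + (a1 + a2 + a3 + a4 + a5 + a6) <= b6 + b5 + (a + b1 + b2 + b3 + b4).
Proof. lra. Qed.

Lemma measurable_deviation {R : realType} {d : measure_display}
    {Omega : measurableType d} (X : Omega -> R) (eps mu : R) :
  measurable_fun setT X -> measurable [set w | eps <= `|X w - mu|].
Proof.
move=> mX; have mg : measurable_fun setT (fun w => `|X w - mu|).
  by apply: measurableT_comp => //; exact: measurable_funB.
have -> : [set w | eps <= `|X w - mu|] =
    (fun w => `|X w - mu|) @^-1` `[eps, +oo[%classic.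
  by apply/seteqP; split => w /=; rewrite in_itv/= andbT.
by rewrite -[_ @^-1` _]setTI; apply: mg => //; exact: measurable_itv.
Qed.

(** * Deviation bound in one window *)

Section WindowBound.
Context {R : realType} {d : measure_display} {Omega : measurableType d}
  (P : probability Omega R) {V E : choiceType} (ends : E -> V * V)
  (tau : E -> nat -> Omega -> R) (f : R -> V -> Omega -> R) (o : V).
Hypothesis conn : connected_graph ends.
Hypothesis tau_meas : forall e k, measurable_fun setT (tau e k).
Hypothesis tau_exp : forall e k, exponential1 P (tau e k).
Hypothesis f_meas : forall t v, measurable_fun setT (f t v).
Hypothesis f0_bound : forall v w, -1 <= f 0 v w <= 1.
Hypothesis f0_id : forall v v', identically_distributed P (f 0 v) (f 0 v').
Hypothesis indep : mutually_independent P
    (fun i : (E * nat) + V =>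
       match i with inl (e, k) => tau e k | inr v => f 0 v end).
Hypothesis dyn : {ae P, forall w, edge_averaging_path ends tau f w}.
Variables (t eps : R).
Hypothesis t_ge0 : 0 <= t.
Let S : R := Num.sqrt (tstar V t).
Hypothesis S_ge6 : 6 <= S.

(** The leading terms come from Hoeffding when [Q <= q] and from the decay estimate for [Q > q]. The
    error terms account, in order, for two rings in one bin, more than [K] rings, close pairs, rings
    after bin [M], and a support of more than [r] vertices. *)
Lemma window_bound {VT ET : finType} (iV : VT -> V) (iE : ET -> E)
    (en : ET -> VT * VT) (rk : VT -> nat) (c : VT) (r D M K L : nat) :
  window ends o r D iV iE en rk c ->
  (0 < r)%N -> (0 < M)%N -> (0 < K)%N -> (0 < L)%N ->
  let dl := t / M%:R in let g : R := #|ET|%:R in let N := (M + K)%N in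
  let w1 := @w_ring R ET dl in
  dl <= 1 / 2 -> g * dl <= 1 / 2 -> 0 < eps - 2 * (2 / L%:R) ->
  fine (P [set w | eps <= `|f t o w - fine ('E_P[f 0 o])|]) <=
    2 * expR (- ((eps - 2 * (2 / L%:R)) ^+ 2 * S / 12)) + expR (- (S / 12)) +
    (N%:R * (g * dl) ^+ 2 + N%:R * (g * w1) / K%:R +
     N%:R * (g * w1 * (K%:R * (g * w1))) + K%:R * (g * w1) +
     (1 + D%:R * w1) ^+ N / r%:R).
Proof.
move=> W r0 M0 K0 L0 dl g N w1 dl2 gdl2 eps'0.
pose w0 := @w_silent R ET dl.
have M0' : 0 < M%:R :> R by rewrite ltr0n.
have tE : t = M%:R * dl by rewrite /dl mulrCA divff ?mulr1// gt_eqF.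
have dl0 : 0 <= dl by rewrite divr_ge0// ltW.
have w0_0 : 0 <= w0 := w_silent_ge0 ET dl.
have w1_0 : 0 <= w1 := w_ring_ge0 ET dl0.
have w_le1 : w0 + g * w1 <= 1 := weights_le1 ET dl0.
have w1_1 : w1 <= 1 by have := w_ring_le ET dl0 dl2; rewrite -/w1; lra.
have loopless := window_loopless W.
(* One [eta] is lost in rounding the opinions, another in rounding the mean. *)
pose eta : R := 2 / L%:R; pose eps' := eps - 2 * eta.
have eta0 : 0 < eta by rewrite divr_gt0// ltr0n.
(* This value makes Hoeffding's exponent [eps'^2 / (2 q)] equal to [eps'^2 S / 12]. *)
pose q := 6 / S; have S0 : 0 < S by exact: lt_le_trans S_ge6.
have q0 : 0 < q by rewrite divr_gt0.
pose B : {set VT} := [set v | (rk v < r)%N]%SET.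
(* Since [2 / q = S / 3], such a set has fewer than [S] vertices and misses some vertex of [V]. *)
have cut : small_sets_have_boundary en B q.
  move=> H H0 HB Hq; have Hlt : #|H|%:R < S.
    by apply: lt_le_trans Hq _; rewrite /q invf_div mulrA ler_pdivrMr//; lra.
  have [z zH] := tstar_outside (window_iV_inj W) Hlt.
  by apply: (window_boundary conn W H0 HB) => v vH; apply/eqP/zH.
pose y := @cell_base R L; pose cell := @grid_cell R L.
pose nu := cell_prob P (f 0) cell o.
pose mean := \sum_j nu j * y j.
pose mu := fine ('E_P[f 0 o]).
have cell_meas j : measurable (cell j) by exact: measurable_itv.
have cell_cover v w : exists j, cell j (f 0 v w).
  by apply: grid_cell_cover => //; exact: f0_bound.
have cell_disj j j' z : cell j z -> cell j' z -> j = j' by exact: grid_cell_disj.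
have cellE j z : cell j z -> y j <= z <= y j + eta.
  by rewrite /cell grid_cellE => /andP[-> /ltW].
have mean_near : 0 <= mu - mean <= eta.
  exact: (mean_discretisation P (f_meas 0 o) (f0_bound o) cell_meas (cell_cover o)
    cell_disj cellE).
have nu0 j : 0 <= nu j by exact: cell_prob_ge0.
have nu1 : \sum_j nu j = 1.
  exact: (sum_cell_prob P o (f_meas 0) cell_meas cell_cover cell_disj).
pose badA (a : seq (option ET)) := [|| (K < count (@rung ET) a)%N,
  (0 < close_pairs K a)%N, (0 < count (@rung ET) (drop M a))%N,
  (r < #|supp (frag en c a : VT -> R)|)%N |
  (q < sqnorm (frag en c a)) && (supp (frag en c a : VT -> R) \subset B)].
pose dev (a : seq (option ET)) (x : {ffun VT -> 'I_L.+1}) :=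
  (sqnorm (frag en c a) <= q) &&
  (eps' <= `|\sum_v frag en c a v * y (x v) - mean|).
pose Ev := [set w | eps <= `|f t o w - mu|].
have mEv : measurable Ev by exact: measurable_deviation.
have [Z [mZ Z0 Zsub]] : {ae P, forall w, edge_averaging_path ends tau f w /\
    forall k e, 0 < tau (iE e) k w}.
  apply: filterI; first exact: dyn.
  apply/ae_foralln => k; apply: filter_forall => e.
  exact: exponential_gt0_ae.
have bad_ok w a x : size a = N -> Ev w -> ~ Z w ->
    pattern_event iV iE tau (f 0) cell dl a x w -> badA a || dev a x.
  move=> sa Ew Zw [gaps cells]; case: (boolP (badA a)) => //= nbad.
  have [path_w tau0] : edge_averaging_path ends tau f w /\
      forall k e, 0 < tau (iE e) k w.
    by apply: contrapT => H; apply: Zw; exact: Zsub.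
  move: nbad; rewrite /badA !negb_or -!leqNgt !leqn0.
  move=> /and5P[few /eqP close /eqP late small].
  have suppB : supp (frag en c a : VT -> R) \subset B.
    apply/fintype.subsetP => v vS; rewrite inE; apply: leq_trans small.
    exact: (supp_frag_rank (window_rk0 W) (window_rk12 W) (window_rk21 W)).
  rewrite suppB andbT -leNgt => Qq.
  pose T e k := tau (iE e) k w.
  have T0 e k : 0 < T e k by exact: tau0.
  have rep : f t o w = \sum_v frag en c a v * f 0 (iV v) w.
    rewrite -(window_center W).
    apply: (@frag_representation R VT ET V E en ends iV iE B
      (fun e s => rings tau e w s) (fun s v => f s v w) t c loopless
      (window_iV_inj W) (window_ends W) _ t_ge0 path_w.1 path_w.2 a (ring_time T a)).
    - by move=> v; rewrite inE => vr e ev; exact: (window_interior W vr ev).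
    - move=> i e ai; split.
        by have [[n E'] _ _] := ring_time_at dl0 gaps few ai; exists n.
      exact: (ring_time_gt0_le dl0 tE T0 gaps few late ai).
    - move=> i j e e'; exact: (ring_time_lt dl0 gaps few close).
    - move=> e s [n ->] /andP[_ le_t].
      exact: (ring_time_exists dl0 tE T0 sa gaps few le_t).
    - exact: suppB.
  rewrite /dev Qq /=.
  have near : `|\sum_v frag en c a v * y (x v) - f t o w| <= eta.
    rewrite rep -sumrB; apply: le_trans (ler_norm_sum _ _ _) _.
    rewrite -[leRHS]mul1r -(frag_sum loopless c a) mulr_suml.
    apply: ler_sum => v _; have m0 : 0 <= frag en c a v :> R by exact: frag_ge0.
    rewrite -mulrBr normrM ger0_norm// ler_wpM2l// ler_norml.
    by have := cellE _ _ (cells v); lra.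
  move: Ew; rewrite /Ev/= -/mu => Ew.
  have h1 : `|f t o w - mu| <= `|f t o w - \sum_v frag en c a v * y (x v)| +
     `|\sum_v frag en c a v * y (x v) - mean| + `|mean - mu|.
    apply: le_trans (ler_distD mean _ _) _; rewrite lerD2r.
    exact: ler_distD.
  have h2 : `|mean - mu| <= eta by rewrite ler_norml; lra.
  by rewrite (distrC (f t o w) (\sum_v _)) in h1; rewrite /eps'; lra.
have := event_bound o (window_iV_inj W) (window_iE_inj W) dl0 tau_meas tau_exp
  (f_meas 0) f0_id indep cell_meas cell_cover cell_disj mEv mZ Z0 bad_ok.
rewrite (probability_fineE P mEv) lee_fin => /le_trans; apply.
rewrite -/w0 -/w1.
pose X5 := 2 * expR (- (eps' ^+ 2 * S / 12)).
have X5_0 : 0 <= X5 by rewrite mulr_ge0// expR_ge0.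
pose ind5 (a : seq (option ET)) : R :=
  ((q < sqnorm (frag en c a)) && (supp (frag en c a : VT -> R) \subset B))%:R.
(* Markov's inequality termwise: each bad indicator is at most the matching count over its
   threshold. *)
have step1 (a : seq (option ET)) :
    \sum_(x : {ffun VT -> 'I_L.+1}) (\prod_v nu (x v)) * (badA a || dev a x)%:R <=
    ((K%:R^-1 * (count (@rung ET) a)%:R + (close_pairs K a)%:R +
     (count (@rung ET) (drop M a))%:R +
     r%:R^-1 * #|supp (frag en c a : VT -> R)|%:R + ind5 a) + X5).
  have nuP (x : {ffun VT -> 'I_L.+1}) : 0 <= \prod_v nu (x v) by exact: prodr_ge0.
  have sum_nuP : \sum_(x : {ffun VT -> 'I_L.+1}) \prod_v nu (x v) = 1.
    by rewrite -(bigA_distr_bigA (fun _ => nu)) big1.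
  apply: (@le_trans _ _ ((badA a)%:R + X5)).
    apply: (@le_trans _ _ (\sum_(x : {ffun VT -> 'I_L.+1}) (\prod_v nu (x v)) * (badA a)%:R +
        \sum_(x : {ffun VT -> 'I_L.+1}) (\prod_v nu (x v)) * (dev a x)%:R)).
      rewrite -big_split/=; apply: ler_sum => x _; rewrite -mulrDr ler_wpM2l//.
      by case: (badA a); case: (dev a x); rewrite /= ?addr0 ?add0r// lerDl.
    rewrite -mulr_suml sum_nuP mul1r lerD2l.
    have [Qq|Qq] := boolP (sqnorm (frag en c a) <= q); last first.
      by rewrite big1// => x _; rewrite /dev (negPf Qq) /= mulr0.
    have Q0 := @sqnorm_frag_gt0 R _ _ _ loopless c a.
    have yb j : -1 <= y j <= 1 by exact: cell_base_bound.
    have := hoeffding nu0 nu1 yb Q0 eps'0 (frag_sum loopless c a).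
    rewrite -/mean => hoef.
    apply: le_trans (_ : _ <= 2 * expR (- (eps' ^+ 2 / (2 * sqnorm (frag en c a))))) _.
      apply: le_trans hoef; apply: ler_sum => x _.
      by rewrite /dev Qq.
    rewrite /X5 ler_wpM2l// ler_expR lerN2.
    have -> : eps' ^+ 2 * S / 12 = eps' ^+ 2 / (2 * q).
      by rewrite /q; field; rewrite gt_eqF.
    rewrite ler_wpM2l ?sqr_ge0// lef_pV2 ?posrE; [|exact: mulr_gt0|exact: mulr_gt0].
    by rewrite ler_pM2l.
  rewrite lerD2r.
  have p1 : 0 <= K%:R^-1 * (count (@rung ET) a)%:R :> R by rewrite mulr_ge0.
  have p2 : 0 <= (close_pairs K a)%:R :> R by [].
  have p3 : 0 <= (count (@rung ET) (drop M a))%:R :> R by [].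
  have p4 : 0 <= r%:R^-1 * #|supp (frag en c a : VT -> R)|%:R :> R by rewrite mulr_ge0.
  have p5 : 0 <= ind5 a by [].
  rewrite /badA; case: ltnP => [h|_] /=.
    have : 1 <= K%:R^-1 * (count (@rung ET) a)%:R :> R.
      by rewrite ler_pdivlMl ?ltr0n// mulr1 ler_nat ltnW.
    by move: p1 p2 p3 p4 p5; lra.
  case: ltnP => [h|_] /=.
    have : 1 <= (close_pairs K a)%:R :> R by rewrite ler1n.
    by move: p1 p2 p3 p4 p5; lra.
  case: ltnP => [h|_] /=.
    have : 1 <= (count (@rung ET) (drop M a))%:R :> R by rewrite ler1n.
    by move: p1 p2 p3 p4 p5; lra.
  case: ltnP => [h|_] /=.
    have : 1 <= r%:R^-1 * #|supp (frag en c a : VT -> R)|%:R :> R.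
      by rewrite ler_pdivlMl ?ltr0n// mulr1 ler_nat ltnW.
    by move: p1 p2 p3 p4 p5; lra.
  by rewrite -/(ind5 a); move: p1 p2 p3 p4 p5; lra.
have step2 := wsum_le w0_0 w1_0 (n := N) (fun a _ => step1 a).
move: step2; rewrite !wsumD [wsum _ _ _ (fun=> K%:R^-1 * _)]wsumZ.
rewrite [wsum _ _ _ (fun=> r%:R^-1 * _)]wsumZ => step2.
have b0 : 1 - wsum w0 w1 N (fun _ : seq (option ET) => 1) <= N%:R * (g * dl) ^+ 2.
  rewrite wsum_const mul1r lerBlDl -lerBlDr.
  exact: total_weight_ge.
have b1 := wsum_count w0_0 w1_0 w_le1 N.
have b2 := wsum_close_pairs w0_0 w1_0 w_le1 K N.
have b3 := wsum_drop w0_0 w1_0 w_le1 M K.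
have b4 := wsum_card_supp c w0_0 w1_0 w_le1 N (window_degree W).
have b5 := wsum_sqnorm_gt c loopless w0_0 w1_0 w_le1 N cut q0 w1_1.
have b6 : wsum w0 w1 N (fun _ : seq (option ET) => X5) <= X5.
  exact: wsum_const_le.
(* Here [(1 - w1 / 9)^N <= e^(- N w1 / 9) <= e^(- t / 18)], from [w1 >= dl / 2] and [N >= M]. *)
have b5' : expR (q ^- 2) * (1 - w1 / 9) ^+ N <= expR (- (S / 12)).
  have w1dl : dl / 2 <= w1 := w_ring_ge dl0 gdl2.
  apply: (@le_trans _ _ (expR (q ^- 2) * expR (- (t / 18)))).
    rewrite ler_wpM2l ?expR_ge0//.
    apply: (@le_trans _ _ (expR (- (w1 / 9)) ^+ N)).
      apply: lerXn2r; rewrite ?nnegrE ?expR_ge0//; first by lra.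
      exact: expR_ge1Dx.
    rewrite -expRM_natl ler_expR mulrN lerN2 tE.
    have -> : M%:R * dl / 18 = M%:R * (dl / 2 / 9) by field.
    apply: ler_pM => //; first by rewrite !divr_ge0.
      by rewrite ler_nat leq_addr.
    by rewrite ler_pM2r// invr_gt0.
  rewrite -expRD ler_expR.
  have SS : S ^+ 2 <= t.
    by rewrite /S sqr_sqrtr ?tstar_ge0//; exact: tstar_le.
  have -> : q ^- 2 = S ^+ 2 / 36 by rewrite /q; field; rewrite gt_eqF.
  exact: square_rate_le.
have c1 : K%:R^-1 * wsum w0 w1 N (fun a : seq (option ET) => (count (@rung ET) a)%:R) <=
    N%:R * (g * w1) / K%:R.
  by rewrite [leRHS]mulrC ler_wpM2l// invr_ge0.
have c4 : r%:R^-1 * wsum w0 w1 N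
    (fun a : seq (option ET) => #|supp (frag en c a : VT -> R)|%:R) <=
    (1 + D%:R * w1) ^+ N / r%:R.
  by rewrite [leRHS]mulrC ler_wpM2l// invr_ge0.
rewrite -/eta -/eps' -/X5; apply: le_trans (lerD b0 step2) _.
exact: (lerD6 _ c1 b2 b3 c4 (le_trans b5 b5') b6).
Qed.
End WindowBound.

(** The ring-count term and the support term get [kappa / 3] each; the other three carry a factor
    [dl] and share the last third. *)
Lemma window_error_le {R : realType} (t g D K r N dl w1 T kappa : R) :
  0 <= t -> 0 <= g -> 0 < K -> 0 < r -> 0 <= N -> 0 <= dl ->
  0 <= w1 <= 2 * dl -> N * dl <= 2 * t ->
  12 * t * g <= kappa * K -> T <= expR (4 * D * t) ->
  3 * expR (4 * D * t) <= kappa * r ->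
  3 * (dl * (2 * t * g ^+ 2 + 8 * t * g ^+ 2 * K + 2 * K * g)) <= kappa ->
  N * (g * dl) ^+ 2 + N * (g * w1) / K + N * (g * w1 * (K * (g * w1))) +
    K * (g * w1) + T / r <= kappa.
Proof.
move=> t0 g0 K0 r0 N0 dl0 /andP[w0 w2] Ndl hK hT hr hdl.
have T1 : N * (g * dl) ^+ 2 <= dl * (2 * t * g ^+ 2).
  have -> : N * (g * dl) ^+ 2 = g ^+ 2 * dl * (N * dl) by ring.
  have -> : dl * (2 * t * g ^+ 2) = g ^+ 2 * dl * (2 * t) by ring.
  by rewrite ler_wpM2l// mulr_ge0// sqr_ge0.
have Nw : N * w1 <= 4 * t.
  by have := ler_wpM2l N0 w2; lra.
have T2 : N * (g * w1) / K <= kappa / 3.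
  rewrite ler_pdivrMr// mulrCA; have := ler_wpM2l g0 Nw; lra.
have gw : g * w1 <= 2 * (g * dl) by have := ler_wpM2l g0 w2; lra.
have T3 : N * (g * w1 * (K * (g * w1))) <= dl * (8 * t * g ^+ 2 * K).
  have -> : N * (g * w1 * (K * (g * w1))) = (g * K * (N * w1)) * (g * w1) by ring.
  have -> : dl * (8 * t * g ^+ 2 * K) = (g * K * (4 * t)) * (2 * (g * dl)) by ring.
  have gK : 0 <= g * K by rewrite mulr_ge0// ltW.
  apply: ler_pM => //; [by apply: mulr_ge0 (mulr_ge0 _ _)|exact: mulr_ge0|].
  exact: ler_wpM2l.
have T4 : K * (g * w1) <= dl * (2 * K * g).
  by have := ler_wpM2l (ltW K0) gw; lra.
have T5 : T / r <= kappa / 3 by rewrite ler_pdivrMr//; lra.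
by move: hdl; rewrite !mulrDr; lra.
Qed.

Lemma nat_gt {R : realType} (x : R) : exists2 n : nat, (0 < n)%N & x < n%:R.
Proof.
exists (Num.truncn `|x|).+1 => //; apply: le_lt_trans (ler_norm x) _.
by have /andP[] := truncn_itv (normr_ge0 x).
Qed.

(** * Removal of the discretisation *)

Section Concentration.
Context {R : realType} {d : measure_display} {Omega : measurableType d}
  (P : probability Omega R) {V E : choiceType} (ends : E -> V * V)
  (tau : E -> nat -> Omega -> R) (f : R -> V -> Omega -> R) (o : V).
Hypothesis simp : simple_graph ends.
Hypothesis conn : connected_graph ends.
Hypothesis bdeg : bounded_degree ends.
Hypothesis tau_meas : forall e k, measurable_fun setT (tau e k).
Hypothesis tau_exp : forall e k, exponential1 P (tau e k).
Hypothesis f_meas : forall t v, measurable_fun setT (f t v).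
Hypothesis f0_bound : forall v w, -1 <= f 0 v w <= 1.
Hypothesis f0_id : forall v v', identically_distributed P (f 0 v) (f 0 v').
Hypothesis indep : mutually_independent P
    (fun i : (E * nat) + V =>
       match i with inl (e, k) => tau e k | inr v => f 0 v end).
Hypothesis dyn : {ae P, forall w, edge_averaging_path ends tau f w}.

Lemma deviation_bound_grid (t eps : R) (L : nat) :
  0 <= t -> 6 <= Num.sqrt (tstar V t) -> (0 < L)%N -> 0 < eps - 2 * (2 / L%:R) ->
  fine (P [set w | eps <= `|f t o w - fine ('E_P[f 0 o])|]) <=
    2 * expR (- ((eps - 2 * (2 / L%:R)) ^+ 2 * Num.sqrt (tstar V t) / 12)) +
    expR (- (Num.sqrt (tstar V t) / 12)).
Proof.
move=> t0 S6 L0 eps0; apply/ler_addgt0Pr => kappa kappa0.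
have [D degD] := bdeg.
(* The order of choice matters: [r] fixes the window and thus [g], then [K] depends on [g], and [M]
   on both. *)
have [r r0 rlt] := nat_gt (3 * expR (4 * D%:R * t) / kappa).
have [VT [ET [iV [iE [en [rk [c W]]]]]]] := window_exists o conn degD simp r.
pose g : R := #|ET|%:R; have g0 : 0 <= g by [].
have [K K0 Klt] := nat_gt (12 * t * g / kappa).
pose C := 2 * t * g ^+ 2 + 8 * t * g ^+ 2 * K%:R + 2 * K%:R * g.
have g2 : 0 <= g ^+ 2 by exact: sqr_ge0.
have C0 : 0 <= C.
  by rewrite /C; apply: addr_ge0; [apply: addr_ge0|]; repeat apply: mulr_ge0 => //.
(* The summands give in turn [dl <= 1 / 2], [g dl <= 1 / 2], [K <= M], and errors proportional to
   [dl] below [kappa / 3]. *)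
have [M M0 Mlt] := nat_gt (2 * t + 2 * t * g + K%:R + 3 * t * C / kappa).
have Mr0 : 0 < M%:R :> R by rewrite ltr0n.
have tg0 : 0 <= 2 * t * g by rewrite !mulr_ge0.
have tC0 : 0 <= 3 * t * C / kappa by rewrite divr_ge0 ?mulr_ge0// ltW.
have K0' : 0 <= K%:R :> R by [].
pose dl := t / M%:R; have dl0 : 0 <= dl by rewrite divr_ge0.
have dlM : dl * M%:R = t by rewrite divfK// gt_eqF.
have dl2 : dl <= 1 / 2 by rewrite ler_pdivrMr//; lra.
have gdl2 : g * dl <= 1 / 2 by rewrite mulrA ler_pdivrMr//; lra.
have KM : K%:R <= M%:R :> R by lra.
apply: le_trans (window_bound conn tau_meas tau_exp f_meas f0_bound f0_id indep
  dyn t0 S6 W r0 M0 K0 L0 dl2 gdl2 eps0) _.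
rewrite lerD2l; apply: (window_error_le (t := t) (D := D%:R)) => //.
- by rewrite ltr0n.
- by rewrite ltr0n.
- by rewrite w_ring_ge0// w_ring_le.
- rewrite natrD mulrDl ![_ * dl]mulrC dlM.
  have := ler_wpM2l dl0 KM; rewrite dlM; lra.
- by move: Klt; rewrite ltr_pdivrMr// => /ltW; rewrite [kappa * _]mulrC.
- set w1 := w_ring dl; have w0 : 0 <= w1 := w_ring_ge0 ET dl0.
  have w2 : w1 <= 2 * dl := w_ring_le ET dl0 dl2.
  apply: (@le_trans _ _ (expR (D%:R * w1) ^+ (M + K))).
    apply: lerXn2r; rewrite ?nnegrE ?expR_ge0//; last exact: expR_ge1Dx.
    by rewrite addr_ge0// mulr_ge0.
  rewrite -expRM_natl ler_expR mulrCA -mulrA [4 * _]mulrC -mulrA.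
  rewrite ler_wpM2l// [_ * 4]mulrC natrD.
  have := ler_wpM2l w0 KM; have := ler_wpM2r (ltW Mr0) w2.
  by move: dlM; nra.
- by move: rlt; rewrite ltr_pdivrMr// => /ltW; rewrite [kappa * _]mulrC.
- have : 3 * t * C / kappa <= M%:R by lra.
  rewrite ler_pdivrMr// => h.
  rewrite -/C -(ler_pM2r Mr0).
  have -> : 3 * (dl * C) * M%:R = 3 * (dl * M%:R) * C by ring.
  by rewrite dlM [kappa * _]mulrC.
Qed.

(** As [L] grows, the grid costs only a factor [e^(eta s / 3)]. Since [eps < 1], the term
    [e^(- s / 12)] is absorbed, and [2 + 1 = 3]. *)
Lemma deviation_bound_large (t eps : R) :
  0 <= t -> 0 < eps < 1 -> 6 <= Num.sqrt (tstar V t) ->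
  fine (P [set w | eps <= `|f t o w - fine ('E_P[f 0 o])|]) <=
    3 * expR (- (eps ^+ 2 * Num.sqrt (tstar V t)) / 12).
Proof.
move=> t0 /andP[e0 e1] S6.
have := fun L => @deviation_bound_grid t eps L t0 S6; set p := fine (P _).
move: S6; set s := Num.sqrt _ => s6 grid.
apply/ler_addgt0Pr => kappa kappa0.
(* The summands ensure [2 eta < eps], [eta s / 3 <= 1 / 2], and a total loss [4 (eta s / 3)] of at
   most [kappa]. *)
have [L L0 Llt] := nat_gt (4 / eps + 2 * s + 3 * s / kappa).
have Lr0 : 0 < L%:R :> R by rewrite ltr0n.
have a0 : 0 < 4 / eps by rewrite divr_gt0.
have b0 : 0 < 3 * s / kappa by rewrite divr_gt0// mulr_gt0//; lra.
pose eta : R := 2 / L%:R; have eta0 : 0 < eta by rewrite divr_gt0.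
have etaL : eta * L%:R = 2 by rewrite divfK// gt_eqF.
have eps4 : 2 * eta < eps.
  rewrite -(ltr_pM2r Lr0) -mulrA etaL.
  have : 4 / eps < L%:R by lra.
  by rewrite ltr_pdivrMr//; lra.
have u1 : eta * s / 3 <= 1 / 2.
  have : eta * (2 * s) <= eta * L%:R by rewrite ler_wpM2l ?ltW//; lra.
  by rewrite etaL; lra.
have u2 : 4 * (eta * s / 3) <= kappa.
  have : 3 * s / kappa <= L%:R by lra.
  rewrite ler_pdivrMr// => /(ler_wpM2l (ltW eta0)); rewrite [leRHS]mulrA etaL; lra.
have u0 : 0 <= eta * s / 3 by rewrite divr_ge0// mulr_ge0 ?ltW//; lra.
have := grid L L0; rewrite -/eta => /(_ _) /le_trans; apply; first by lra.
set X := expR (- (eps ^+ 2 * s) / 12).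
have X0 : 0 < X by exact: expR_gt0.
have X1 : X <= 1.
  rewrite -expR0 ler_expR mulNr oppr_le0 divr_ge0// mulr_ge0 ?sqr_ge0//; lra.
have h1 : expR (- (s / 12)) <= X.
  rewrite ler_expR mulNr lerN2 ler_pM2r//.
  rewrite -[leRHS]mul1r ler_wpM2r//; first by lra.
  by rewrite exprn_ile1// ltW.
have h2 : expR (- ((eps - 2 * eta) ^+ 2 * s / 12)) <= X * expR (eta * s / 3).
  rewrite -expRD ler_expR.
  have : 0 <= (4 * eta * (1 - eps) + 4 * eta ^+ 2) * s.
    have h : 0 <= eta * (1 - eps) by apply: mulr_ge0; lra.
    have h' : 0 <= eta ^+ 2 by exact: sqr_ge0.
    by apply: mulr_ge0; lra.
  by rewrite sqrrB; lra.
have h3 : X * expR (eta * s / 3) <= X + 2 * (eta * s / 3).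
  have := ler_wpM2l (ltW X0) (expR_le1D2x u0 u1).
  have := ler_wpM2r u0 X1; lra.
lra.
Qed.

(** For [sqrt t_* < 6] the exponent is at least [- 1 / 2], so the right side is at least
    [3 (1 - 1 / 2) >= 1]. *)
Lemma deviation_bound (t eps : R) : 0 <= t -> 0 < eps < 1 ->
  (P [set w | (eps <= `|f t o w - fine ('E_P[f 0 o])|)%R] <=
      ((3 * expR (- (eps ^+ 2 * Num.sqrt (tstar V t)) / 12))%R)%:E)%E.
Proof.
move=> t0 e01; set mu := fine _.
have mEv : measurable [set w | eps <= `|f t o w - mu|] by exact: measurable_deviation.
rewrite (probability_fineE P mEv) lee_fin.
have [S6|S6] := leP 6 (Num.sqrt (tstar V t)); first exact: deviation_bound_large.
apply: (@le_trans _ _ 1).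
  by rewrite -lee_fin -probability_fineE// probability_le1.
move: (sqrtr_ge0 (tstar V t)) S6; set s := Num.sqrt _ => s0 s6.
have es : eps ^+ 2 * s <= 6.
  move: e01 => /andP[e0 e1]; apply: le_trans (ltW s6).
  by rewrite ler_piMl// exprn_ile1// ltW.
by have := expR_ge1Dx (- (eps ^+ 2 * s) / 12); lra.
Qed.
End Concentration.

Theorem theorem1p2 (R : realType) (d : measure_display) (Omega : measurableType d)
  (P : probability Omega R)
  (V E : Type) (ends : E -> V * V)
  (tau : E -> nat -> Omega -> R) (f : R -> V -> Omega -> R) (o : V) :
  simple_graph ends -> connected_graph ends -> bounded_degree ends ->
  (* clocks: i.i.d. Exp(1) interarrival times; initial opinions f 0 v *)
  (forall e k, measurable_fun setT (tau e k)) ->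
  (forall e k, exponential1 P (tau e k)) ->
  (forall t v, measurable_fun setT (f t v)) ->
  (forall v w, -1 <= f 0 v w <= 1) ->
  (forall v v', identically_distributed P (f 0 v) (f 0 v')) ->
  mutually_independent P
    (fun i : (E * nat) + V =>
       match i with inl (e, k) => tau e k | inr v => f 0 v end) ->
  (* almost surely, f follows the edge-averaging dynamics *)
  {ae P, forall w, edge_averaging_path ends tau f w} ->
  forall (t eps : R), 0 <= t -> 0 < eps < 1 ->
    let mu := fine ('E_P[f 0 o]) in
    (P [set w | (eps <= `|f t o w - mu|)%R] <=
      ((3 * expR (- (eps ^+ 2 * Num.sqrt (tstar V t)) / 12))%R)%:E)%E.
Proof.
move=> simp conn bdeg tau_meas tau_exp f_meas f0_bound f0_id indep dyn t eps t0 e01.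
(* [{classic V}] and [{classic E}] supply the choice structures on which the finite windows are
   built. *)
exact: (@deviation_bound R d Omega P {classic V} {classic E} ends tau f o
  simp conn bdeg tau_meas tau_exp f_meas f0_bound f0_id indep dyn t eps t0 e01).
Qed.
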